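(* Let $\ell:\mathbb{N}\to\mathbb{N}$ satisfy $\ell(m)=o\!\left(\frac{m}{\log m}\right)$. Then, for any $\ell$-index-based improvement rule $\Pi^P$, there is a family $(\mathcal{G}_m)_{m\in\mathbb{N}}$ of sink parity games, where $\mathcal{G}_m$ has $m$ player 0 edges, such that strategy improvement with improvement rule $\Pi^P$ requires $m^{\omega(1)}$ (i.e. superpolynomially many in $m$) iterations to find the optimal strategy.
   Context: A sink parity game is a tuple $(V_0,V_1,E,\pi)$ specifying a directed graph on $V_G=V_0\cup V_1\cup\{\top\}$ (disjoint union) in which every vertex has an outgoing edge, the sink $\top$ has only the self-loop $(\top,\top)$ as outgoing edge, and $\pi:V_G\to\mathbb{Z}\cup\{-\infty\}$ is a priority function with $\pi(\top)=-\infty$ and $\pi(v)\in\mathbb{Z}$ for $v\ne\top$. Player $i$ owns $V_i$; player 0 edges are the edges leaving $V_0$. A player-$i$ strategy is a map $\sigma:V_i\to V_G$ with $(v,\sigma(v))\in E$; let $E_{\sigma}$ consist of the edges $(v,\sigma(v))$, $v\in V_i$, together with all edges leaving vertices not in $V_i$. A player 0 strategy $\sigma$ is admissible if every cycle of $E_\sigma$ not containing $\top$ has even highest priority; it is assumed that the game has an admissible player 0 strategy and a player 1 strategy all of whose cycles (not containing $\top$) have odd highest priority. For finite multisets $S_1,S_2$ of integers, $S_1\triangleleft S_2$ means $\sum_{s\in S_1}(-|V_0\cup V_1|)^s<\sum_{s\in S_2}(-|V_0\cup V_1|)^s$ (counted with multiplicity). For an admissible $\sigma$, let $\bar\sigma$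 be an optimal counterstrategy of player 1 (minimizing the following valuations for all start vertices simultaneously); from each $v_0$ the play under $\sigma,\bar\sigma$ is a simple path $v_0,\dots,v_k,\top$, and $\mathrm{val}_\sigma(v_0)$ is the multiset $\{\pi(v_0),\dots,\pi(v_k)\}$. A player 0 edge $(v,w)$ is an improving switch for $\sigma$ if $\mathrm{val}_\sigma(w)\triangleright\mathrm{val}_\sigma(\sigma(v))$; applying it yields the strategy that agrees with $\sigma$ except that $v\mapsto w$. A strategy is optimal iff it has no improving switch. Strategy improvement starts at an admissible strategy and in each iteration applies one improving switch, chosen by an improvement rule, until an optimal strategy is reached. Each player 0 edge carries a distinct positive integer, its Bland number. Given $\ell:\mathbb{N}\to\mathbb{N}$, an $\ell$-index-selector function is $P:\mathbb{N}^3\to\mathbb{N}^2$ with $P(p,m,h)\in\{1,\dots,p\}\times\{1,\dots,\ell(m)\}$. The induced $\ell$-index-based improvement rule $\Pi^P$ starts in memory state $1$; in a game with $m$ player 0 edges, at a strategy with $p\ge1$ improving switches and memory state $h$, if $P(p,m,h)=(i',h')$ it applies the improving switch with the $i'$-th smallest Bland number among the improving switches and moves to memory state $h'$. *)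

(* Defs.v *)
From mathcomp Require Import all_boot all_order all_algebra.
From Stdlib Require Reals.
Set Implicit Arguments. Unset Strict Implicit. Unset Printing Implicit Defensive.
Import Order.TTheory GRing.Theory Num.Theory.

(* V is the full vertex set V_0 ∪ V_1 ∪ {top}; own0 characterizes V_0;     *)
(* V_1 is everything else except top.  prio top is irrelevant (it is       *)
(* -infinity in the paper and never used: cycles avoid top and valuations *)
(* only collect priorities of non-top vertices).  bland u w is the Bland   *)
(* number of the player 0 edge (u,w).                                      *)
Record spg := SPG {
  V : finType;
  g_top : V;
  g_own0 : {pred V};
  g_E : rel V;
  g_prio : V -> int;
  g_bland : V -> V -> nat
}.

Section SPG.
Variable G : spg.
Local Notation VG := (V G).
Local Notation top := (@g_top G).
Local Notation own0 := (@g_own0 G).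
Local Notation E := (@g_E G).
Local Notation prio := (@g_prio G).
Local Notation bland := (@g_bland G).
Local Open Scope ring_scope.

Definition own1 (v : VG) : bool := (v != top) && ~~ own0 v.

Definition edge0 (u w : VG) : bool := own0 u && E u w.

Definition num_edges0 : nat := #|[pred p : VG * VG | edge0 p.1 p.2]|.

(* strategies are total functions; only their values on V_i matter *)
Definition strat0 (s : {ffun VG -> VG}) : bool := [forall v, own0 v ==> E v (s v)].
Definition strat1 (t : {ffun VG -> VG}) : bool := [forall v, own1 v ==> E v (t v)].

Definition Esig (s : {ffun VG -> VG}) : rel VG :=
  fun u w => if own0 u then w == s u else E u w.
Definition Etau (t : {ffun VG -> VG}) : rel VG :=
  fun u w => if own1 u then w == t u else E u w.

Definition cycle_wo_top (e : rel VG) (c : seq VG) : Prop :=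
  c != [::] /\ uniq c /\ top \notin c /\ cycle e c.

Definition highest_even (c : seq VG) : Prop :=
  exists2 v, v \in c & (forall u, u \in c -> prio u <= prio v) /\ (2 %| prio v)%Z.
Definition highest_odd (c : seq VG) : Prop :=
  exists2 v, v \in c & (forall u, u \in c -> prio u <= prio v) /\ ~~ (2 %| prio v)%Z.

Definition admissible (s : {ffun VG -> VG}) : Prop :=
  strat0 s /\ forall c, cycle_wo_top (Esig s) c -> highest_even c.

Definition odd_cycles1 (t : {ffun VG -> VG}) : Prop :=
  strat1 t /\ forall c, cycle_wo_top (Etau t) c -> highest_odd c.

Definition is_spg : Prop :=
  [/\ ((forall v, exists w, E v w) /\ (forall w, E top w = (w == top))),
      ~~ own0 top,
      (forall u w, edge0 u w -> 0 < bland u w)%N,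
      (forall u w u' w', edge0 u w -> edge0 u' w' ->
          bland u w = bland u' w' -> u = u' /\ w = w') &
      (exists s, admissible s) /\ (exists t, odd_cycles1 t)].

Definition succ (s t : {ffun VG -> VG}) (v : VG) : VG :=
  if v == top then top else if own0 v then s v else t v.

(* the play from v reaches the sink (then necessarily as a simple path,   *)
(* within #|VG| - 1 steps)                                                  *)
Definition reaches (s t : {ffun VG -> VG}) (v : VG) : bool :=
  iter #|VG| (succ s t) v == top.

(* N = |V_0 ∪ V_1|; a priority z contributes (-N)^z *)
Definition weight (z : int) : rat := (- (#|VG|.-1)%:R) ^ z.

(* sum_{s in val(v)} (-N)^s, where val(v) is the multiset of priorities of *)
(* the non-sink vertices of the play from v                               *)
Definition val (s t : {ffun VG -> VG}) (v : VG) : rat :=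
  \sum_(i < #|VG|) (if iter i (succ s t) v != top
                   then weight (prio (iter i (succ s t) v)) else 0).

Definition optimal_counter (s t : {ffun VG -> VG}) : bool :=
  [&& strat1 t, [forall v, reaches s t v] &
      [forall t' : {ffun VG -> VG}, strat1 t' ==>
         [forall v, reaches s t' v ==> (val s t v <= val s t' v)]]].

Definition improving (s : {ffun VG -> VG}) (u w : VG) : bool :=
  edge0 u w &&
  [exists t : {ffun VG -> VG}, optimal_counter s t && (val s t (s u) < val s t w)].

Definition sorted_switches (s : {ffun VG -> VG}) : seq (VG * VG) :=
  sort (fun a b => (bland a.1 a.2 <= bland b.1 b.2)%N)
       (enum [pred p : VG * VG | improving s p.1 p.2]).

Definition apply_switch (s : {ffun VG -> VG}) (e : VG * VG) : {ffun VG -> VG} :=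
  [ffun x => if x == e.1 then e.2 else s x].

(* one iteration of strategy improvement with the rule Pi^P; the state is *)
(* (current strategy, memory state)                                        *)
Definition si_step (P : nat -> nat -> nat -> nat * nat)
    (st : {ffun VG -> VG} * nat) : {ffun VG -> VG} * nat :=
  let: (s, h) := st in
  let S := sorted_switches s in
  if S is e0 :: _ then
    let ih := P (size S) num_edges0 h in
    (apply_switch s (nth e0 S ih.1.-1), ih.2)
  else st.

Definition si_run (P : nat -> nat -> nat -> nat * nat) (s0 : {ffun VG -> VG})
    (k : nat) : {ffun VG -> VG} * nat :=
  iter k (si_step P) (s0, 1%N).

End SPG.

Definition index_selector (l : nat -> nat) (P : nat -> nat -> nat -> nat * nat) : Prop :=
  forall p m h, (0 < p)%N ->
    (0 < (P p m h).1 <= p)%N /\ (0 < (P p m h).2 <= l m)%N.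

Definition little_o_m_over_log (l : nat -> nat) : Prop :=
  forall eps : Reals.Rdefinitions.R, Reals.Rdefinitions.Rlt (Reals.Rdefinitions.IZR BinNums.Z0) eps ->
  exists M : nat, forall m : nat, (M <= m)%N ->
    Reals.Rdefinitions.Rle (Reals.Raxioms.INR (l m))
      (Reals.Rdefinitions.Rmult eps
         (Reals.Rdefinitions.Rdiv (Reals.Raxioms.INR m) (Reals.Rpower.ln (Reals.Raxioms.INR m)))).

(* Main.v *)
From HB Require Import structures.
From mathcomp Require Import all_boot all_order all_algebra.
From Stdlib Require Reals Lra ClassicalEpsilon.
Set Implicit Arguments. Unset Strict Implicit. Unset Printing Implicit Defensive.

(** Player 1 only has forced moves and the graph is acyclic, so a switch is
    improving iff it strictly increases the value of the successor.

    Counter.  There are pairs [(v_i, u_i)], [0 <= i <= n], and [v_(i+1)],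
    [u_(i+1)] each point to one of [v_i], [u_i].  The weights are such that
    [u_(i+1)] beats [v_(i+1)] when both have the same successor, but loses when
    only [v_(i+1)] points to the better vertex of level [i].  Hence each change
    of the better vertex of level [i], followed by switching [v_(i+1)] first and
    [u_(i+1)] second, produces two changes at level [i + 1]: if the improving
    counter switch of highest level is always preferred, the counter runs for
    [2 * (2 ^ n - 1)] switches.

    Constant number of improving switches.  Every vertex [x] choosing between
    [v_i] and [u_i] comes with two vertices [Comp x c] whose alternative is [x]
    and whose current choice is [v_i], resp. [u_i].  Among [x] and these two there
    are always exactly two improving switches.  So the rule always sees the same
    number [p] of improving switches, its memory is eventually periodic, and the
    ranks it picks are known in advance.

    Absorbing the unwanted picks.  If the period is [K + 1], each level has [K]
    fillers, which become improving whenever the better vertex of that level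
    changes; [T] further fillers of level 0 absorb the aperiodic beginning.  Bland
    numbers are chosen backwards in time so that the rule consumes the fillers
    one after the other and then picks the preferred counter switch.  Only the
    set of improving counter switches is unknown when Bland numbers are chosen;
    these switches occupy a window of [4 n] consecutive ranks, which can be kept
    free of other picks since [p] is a large multiple of [n * l m].

    In total [m = O(n * l m)] player 0 edges suffice, so [n / log m] tends to
    infinity. *)

(** * From the growth of [l] to the bound [m ^ c <= 2 ^ n] *)

Section Growth.
Import Reals Lra.
Local Open Scope R_scope.

(** Chaining the two bounds gives [n + 2 >= (2 * c + 4) * ln m]. As [m >= 3] yields [ln m >= 1], it
    follows that [n / 2 >= c * ln m + 1], and [ln 2 > 1 / 2] finishes. The summand 4 pays for the 2
    in [n + 2] and for strictness. *)
Lemma pow_le_of_log (l m n : R) (N c : nat) : n = INR N -> 3 <= m ->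
  l <= / (240 * (2 * INR c + 4)) * (m / ln m) -> m <= (n + 2) * (240 * l) ->
  0 < n /\ pow m c <= pow 2 N.
Proof.
move=> nE m3 le_l dm; set k := 2 * INR c + 4 in le_l.
have c0 : 0 <= INR c by exact: pos_INR.
have k0 : 0 < k by rewrite /k; lra.
have n0 : 0 <= n by rewrite nE; exact: pos_INR.
have lnm : 1 <= ln m.
  rewrite -{1}(ln_exp 1); have [lt|eq] := Rle_lt_or_eq_dec _ _ (Rle_trans _ _ _ exp_le_3 m3).
    by apply: Rlt_le; apply: ln_increasing => //; exact: exp_pos.
  by rewrite eq; apply: Rle_refl.
have le_n : k * ln m <= n + 2.
  have e : m <= (n + 2) * (240 * (/ (240 * k) * (m / ln m))).
    apply: Rle_trans dm _; apply: Rmult_le_compat_l; first lra.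
    by apply: Rmult_le_compat_l => //; lra.
  have e2 : (n + 2) * (240 * (/ (240 * k) * (m / ln m))) =
            m * ((n + 2) / (k * ln m)) by field; lra.
  rewrite e2 in e.
  have kl : 0 < k * ln m by apply: Rmult_lt_0_compat; lra.
  have one : 1 <= (n + 2) / (k * ln m) by apply: (Rmult_le_reg_l m); lra.
  have := Rmult_le_compat_r _ _ _ (Rlt_le _ _ kl) one.
  by rewrite /Rdiv Rmult_assoc Rinv_l; lra.
have big_n : 2 * (INR c * ln m) + 2 <= n.
  have : 4 * 1 <= 4 * ln m by lra.
  by move: le_n; rewrite /k; lra.
have cl : 0 <= INR c * ln m by apply: Rmult_le_pos; lra.
split; first by lra.
rewrite -!Rpower_pow; [|by lra|lra].
rewrite /Rpower -nE; apply: Rlt_le; apply: exp_increasing.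
have l2 := ln_lt_2; apply: (Rlt_le_trans _ (n * / 2)); first by lra.
by apply: Rmult_le_compat_l; lra.
Qed.

Lemma threshold_pos c : 0 < / (240 * (2 * INR c + 4)).
Proof. by apply: Rinv_0_lt_compat; have := pos_INR c; lra. Qed.

Lemma INR_3_240 : INR 3 = 3 /\ INR 240 = 240.
Proof. by split; rewrite INR_IZR_INZ. Qed.
End Growth.

From mathcomp Require Import zify ring lra.
Require Import Defs.
Import Order.TTheory GRing.Theory Num.Theory.
Local Open Scope ring_scope.

(** * The game *)

Section Types.
Variables (n K T C Q : nat).

(* [Real i true] is [v_(i+1)] and [Real i false] is [u_(i+1)]. *)
Inductive follower :=
  | Real of 'I_n & bool | Filler of 'I_n.+1 & 'I_K | Tran of 'I_T.

Definition follower_code (x : follower) :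
  ('I_n * bool) + ('I_n.+1 * 'I_K) + 'I_T :=
  match x with
  | Real i c => inl (inl (i, c)) | Filler i t => inl (inr (i, t))
  | Tran t => inr t end.
Definition follower_decode y : follower :=
  match y with
  | inl (inl (i, c)) => Real i c | inl (inr (i, t)) => Filler i t
  | inr t => Tran t end.
Lemma follower_codeK : cancel follower_code follower_decode.
Proof. by case. Qed.
HB.instance Definition _ := Equality.copy follower (can_type follower_codeK).
HB.instance Definition _ := Choice.copy follower (can_type follower_codeK).
HB.instance Definition _ := Countable.copy follower (can_type follower_codeK).
HB.instance Definition _ := Finite.copy follower (can_type follower_codeK).

Inductive vertex :=
  | Top | Base of bool | Fol of follower | Comp of follower & bool
  | Cst of 'I_C | Pad of 'I_Q.

Definition vertex_code (v : vertex) :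
  option (bool + follower + follower * bool + 'I_C + 'I_Q) :=
  match v with
  | Top => None
  | Base c => Some (inl (inl (inl (inl c))))
  | Fol x => Some (inl (inl (inl (inr x))))
  | Comp x c => Some (inl (inl (inr (x, c))))
  | Cst k => Some (inl (inr k))
  | Pad k => Some (inr k) end.
Definition vertex_decode y : vertex :=
  match y with
  | None => Top
  | Some (inl (inl (inl (inl c)))) => Base c
  | Some (inl (inl (inl (inr x)))) => Fol x
  | Some (inl (inl (inr (x, c)))) => Comp x c
  | Some (inl (inr k)) => Cst k
  | Some (inr k) => Pad k end.
Lemma vertex_codeK : cancel vertex_code vertex_decode.
Proof. by case. Qed.
HB.instance Definition _ := Equality.copy vertex (can_type vertex_codeK).
HB.instance Definition _ := Choice.copy vertex (can_type vertex_codeK).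
HB.instance Definition _ := Countable.copy vertex (can_type vertex_codeK).
HB.instance Definition _ := Finite.copy vertex (can_type vertex_codeK).

(* The edges that can ever be improving, see [edge_of]. *)
Inductive item := Mov of follower & bool | Chk of follower & bool | Gain of 'I_C.
Definition item_code (a : item) : follower * bool + follower * bool + 'I_C :=
  match a with
  | Mov x c => inl (inl (x, c)) | Chk x c => inl (inr (x, c)) | Gain k => inr k
  end.
Definition item_decode y : item :=
  match y with
  | inl (inl (x, c)) => Mov x c | inl (inr (x, c)) => Chk x c | inr k => Gain k
  end.
Lemma item_codeK : cancel item_code item_decode.
Proof. by case. Qed.
HB.instance Definition _ := Equality.copy item (can_type item_codeK).
HB.instance Definition _ := Choice.copy item (can_type item_codeK).
HB.instance Definition _ := Countable.copy item (can_type item_codeK).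
HB.instance Definition _ := Finite.copy item (can_type item_codeK).

End Types.
Arguments Real {n K T}. Arguments Filler {n K T}. Arguments Tran {n K T}.
Arguments Top {n K T C Q}. Arguments Base {n K T C Q}. Arguments Fol {n K T C Q}.
Arguments Comp {n K T C Q}. Arguments Cst {n K T C Q}. Arguments Pad {n K T C Q}.
Arguments Mov {n K T C}. Arguments Chk {n K T C}. Arguments Gain {n K T C}.

Section Game.
Variables (n K T C Q : nat).
Local Notation follower := (follower n K T).
Local Notation vertex := (vertex n K T C Q).
Local Notation item := (item n K T C).

Definition lev (x : follower) : nat :=
  match x with Real i _ => i | Filler i _ => i | Tran _ => 0 end.

(** The default [Top] occurs only beyond level [n], where no follower points. *)
Definition pair (i : nat) (c : bool) : vertex :=
  if i is j.+1 then (if insub j is Some k then Fol (Real k c) else Top) else Base c.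

Lemma pairS (i : 'I_n) c : pair i.+1 c = Fol (Real i c).
Proof. by rewrite /pair valK. Qed.

Lemma lev_le (x : follower) : (lev x <= n)%N.
Proof. by case: x => //= i ?; [exact: ltnW | rewrite -ltnS]. Qed.

Variant pair_spec c : nat -> vertex -> Prop :=
  | PairBase : pair_spec c 0 (Base c)
  | PairReal (i : 'I_n) : pair_spec c i.+1 (Fol (Real i c)).
Lemma pairP i c : (i <= n)%N -> pair_spec c i (pair i c).
Proof.
case: i => [|i] lt_in; first by constructor.
by rewrite -[i]/(nat_of_ord (Ordinal lt_in)) pairS; constructor.
Qed.

Definition own (v : vertex) : bool :=
  match v with Top | Base _ => false | _ => true end.

Definition edge (v w : vertex) : bool :=
  match v with
  | Top | Base _ | Pad _ => w == Top
  | Fol x => (w == pair (lev x) true) || (w == pair (lev x) false)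
  | Comp x c => (w == pair (lev x) c) || (w == Fol x)
  | Cst _ => (w == Top) || (w == Base true)
  end.

(** Decreases along every edge except the loop at [Top]; this makes the game acyclic and bounds the
    length of plays. *)
Definition height (v : vertex) : nat :=
  match v with
  | Top => 0 | Base _ | Pad _ => 1 | Fol x => (lev x).+2
  | Comp x _ => (lev x).+3 | Cst _ => 2
  end.

(** All priorities are even, so all weights are positive. Only the [u] vertices are heavy, and less
    so on higher levels, so that a change of the better vertex below outweighs them. *)
Definition priority (v : vertex) : int :=
  match v with
  | Base false => Posz (n.+1).*2
  | Fol (Real i false) => Posz (n - i).*2
  | _ => 0
  end.

Definition edge_of (a : item) : vertex * vertex :=
  match a with
  | Mov x c => (Fol x, pair (lev x) c)
  | Chk x c => (Comp x c, Fol x)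
  | Gain k => (Cst k, Base true)
  end.

Lemma pair_inj i c c' : (i <= n)%N -> pair i c = pair i c' -> c = c'.
Proof.
move=> le_in; case: i le_in => [_ [->] //|i lt_in].
by rewrite -[i]/(nat_of_ord (Ordinal lt_in)) !pairS => -[].
Qed.

Lemma edge_of_inj : injective edge_of.
Proof.
move=> [x c|x c|k] [y d|y d|l] //= [] => [<-||] => [|-> -> //|-> //].
by move/(pair_inj (lev_le x)) ->.
Qed.

(** The default 0 goes to edges outside the image of [edge_of], which are never improving. *)
Definition edge_key (key : item -> rat) (e : vertex * vertex) : rat :=
  if [pick a | edge_of a == e] is Some a then key a else 0.

Lemma edge_key_of key a : edge_key key (edge_of a) = key a.
Proof.
rewrite /edge_key; case: pickP => [b /eqP /edge_of_inj -> //|/(_ a)].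
by rewrite eqxx.
Qed.

(** Rational keys can be inserted between others at will; the Bland number is the position in the
    list of all pairs sorted by key. Ties are broken arbitrarily, so only strict inequalities of
    keys carry over. *)
Definition bland (key : item -> rat) (u w : vertex) : nat :=
  (index (u, w) (sort (fun e f => edge_key key e <= edge_key key f)
                      (enum {: vertex * vertex}))).+1.

Lemma bland_inj key u w u' w' :
  bland key u w = bland key u' w' -> u = u' /\ w = w'.
Proof.
rewrite /bland; set s := sort _ _ => -[eq_i].
have in_s e : e \in s by rewrite mem_sort mem_enum.
by have := congr1 (nth (u, w) s) eq_i; rewrite !nth_index // => -[-> ->].
Qed.

Lemma bland_lt key u w u' w' :
  edge_key key (u, w) < edge_key key (u', w') ->
  (bland key u w < bland key u' w')%N.
Proof.
move=> lt_k; rewrite /bland ltnS ltnNge; apply/negP => le_i.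
set leT := fun e f => edge_key key e <= edge_key key f in le_i.
have tr : transitive leT by move=> a b c; apply: le_trans.
have rf : reflexive leT by move=> a; apply: lexx.
have srt : sorted leT (sort leT (enum {: vertex * vertex})).
  by apply: sort_sorted => a b; apply: le_total.
have in_s e : e \in sort leT (enum {: vertex * vertex}).
  by rewrite mem_sort mem_enum.
by have := sorted_leq_index tr rf srt _ _ (in_s _) (in_s _) le_i; rewrite /leT leNgt lt_k.
Qed.

Definition game (key : item -> rat) : spg :=
  SPG Top own edge priority (bland key).

Definition strat (b : follower -> bool) : {ffun vertex -> vertex} :=
  [ffun v => match v with
             | Fol x => pair (lev x) (b x)
             | Comp x c => pair (lev x) c
             | _ => Top end].

Definition flip (b : follower -> bool) x : follower -> bool :=
  fun y => if y == x then ~~ b y else b y.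

(** * Acyclicity, size and improving switches of the game *)

Section Fixed.
Variable key : item -> rat.
Local Notation G := (game key).

Lemma height_edge (v w : vertex) : edge v w -> v != Top -> (height w < height v)%N.
Proof.
have hp i c : (i <= n)%N -> (height (pair i c) < i.+2)%N.
  by move=> le_in; case: (pairP c le_in) => /=.
case: v => [|c|x|x c|k|k] //=.
- by move/eqP->.
- by case/orP => /eqP -> _; apply: hp; apply: lev_le.
- by case/orP => /eqP -> _ //; rewrite ltnW // ltnS; apply: hp; apply: lev_le.
- by case/orP => /eqP ->.
- by move/eqP->.
Qed.

Lemma edge_total (v : vertex) : exists w, edge v w.
Proof.
case: v => [|c|x|x c|k|k]; rewrite /edge; try by exists Top; rewrite eqxx.
  by exists (pair (lev x) true); rewrite eqxx.
by exists (Fol x); rewrite eqxx orbT.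
Qed.

(** A vertex of least height on the cycle would have a lower successor. Applied to [Esig] and
    [Etau], this makes the parity conditions of both players vacuous. *)
Lemma no_cycle (e : rel vertex) (c : seq vertex) :
  (forall u w, u != Top -> e u w -> edge u w) -> ~ @cycle_wo_top G e c.
Proof.
move=> sub [c0 [_ [topc cyc]]].
have [v vc vmin] : exists2 v, v \in c & forall u, u \in c -> (height v <= height u)%N.
  case: c c0 topc cyc => // v c _ _ _.
  case: (arg_minnP height (P := mem (v :: c)) (i0 := v)); first exact: mem_head.
  by move=> w wc wmin; exists w.
have := next_cycle cyc vc => /sub; have vt : v != Top.
  by apply: contraNneq topc => vE; rewrite /= -vE.
move=> /(_ vt) /height_edge /(_ vt).
by rewrite ltnNge vmin // mem_next.
Qed.

Lemma strat_strat0 b : @strat0 G (strat b).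
Proof.
apply/forallP => -[|c|x|x c|k|k] //=; rewrite /strat ffunE /= ?eqxx //.
by case: (b x); rewrite eqxx ?orbT.
Qed.

Lemma strat_admissible b : @admissible G (strat b).
Proof.
split; first exact: strat_strat0.
move=> c /no_cycle []// u w _; rewrite /Esig.
have /forallP/(_ u) := strat_strat0 b.
by case: ifP => //= _ su /eqP ->.
Qed.

Lemma strat1E (t : {ffun vertex -> vertex}) :
  @strat1 G t -> forall c, t (Base c) = Top.
Proof. by move=> /forallP st c; have := st (Base c); rewrite /own1 /= => /eqP. Qed.

Lemma top_strat1 : @strat1 G [ffun=> Top].
Proof. by apply/forallP => -[|c|x|x c|k|k] //=; rewrite /own1 //= ffunE. Qed.

Lemma game_is_spg : is_spg G.
Proof.
split=> //.
- by split=> [v|w] //=; apply: edge_total.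
- by move=> u w u' w' _ _; apply: bland_inj.
split; first by exists (strat xpredT); apply: strat_admissible.
exists [ffun=> Top]; split; first exact: top_strat1.
move=> c /no_cycle [] // u w ut; rewrite /Etau.
by case: ifP => // /andP[_]; case: u ut => //= c0 _ _ /eqP ->; rewrite ffunE.
Qed.

Lemma card_vertex :
  #|{: vertex}| = (3 + #|{: follower}| * 3 + C + Q)%N.
Proof.
have -> : #|{: vertex}| = #|{: option (bool + follower + follower * bool + 'I_C + 'I_Q)}|.
  apply: (@bij_eq_card _ _ (@vertex_code n K T C Q)).
  exists (@vertex_decode n K T C Q); first exact: vertex_codeK.
  by move=> [[[[[c|x]|[x c]]|k]|k]|].
rewrite card_option !card_sum card_prod !card_ord card_bool.
by set F := #|_|; lia.
Qed.

Lemma card_follower : #|{: follower}| = (n * 2 + n.+1 * K + T)%N.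
Proof.
have -> : #|{: follower}| = #|{: ('I_n * bool) + ('I_n.+1 * 'I_K) + 'I_T}|.
  apply: (@bij_eq_card _ _ (@follower_code n K T)).
  exists (@follower_decode n K T); first exact: follower_codeK.
  by move=> [[[i c]|[i t]]|t].
by rewrite !card_sum !card_prod !card_ord card_bool.
Qed.


Lemma card_edges : num_edges0 G = (#|{: follower}| * 6 + C * 2 + Q)%N.
Proof.
pose enc (y : follower * bool + follower * bool + follower * bool + 'I_C * bool + 'I_Q) :
    vertex * vertex :=
  match y with
  | inl (inl (inl (inl (x, c)))) => (Fol x, pair (lev x) c)
  | inl (inl (inl (inr (x, c)))) => (Comp x c, Fol x)
  | inl (inl (inr (x, c))) => (Comp x c, pair (lev x) c)
  | inl (inr (k, c)) => (Cst k, if c then Top else Base true)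
  | inr k => (Pad k, Top)
  end.
have fol_pair x c : Fol x <> pair (lev x) c.
  by move=> /(congr1 height) /=; case: (pairP c (lev_le x)) => //= i; lia.
have enc_inj : injective enc.
  move=> [[[[[x c]|[x c]]|[x c]]|[k c]]|k] [[[[[y d]|[y d]]|[y d]]|[l d]]|l] //= [].
  - by move=> <- /(pair_inj (lev_le x)) ->.
  - by move=> -> ->.
  - by move=> <- _ /fol_pair.
  - by move=> <- _ /esym /fol_pair.
  - by move=> -> ->.
  - by move=> ->; case: c; case: d.
  - by move=> ->.
rewrite /num_edges0 (@eq_card _ _ (mem (codom enc))).
  rewrite card_codom // !card_sum !card_prod !card_ord card_bool.
  by set F := #|_|; lia.
move=> [u w]; rewrite inE /=; apply/idP/codomP.
  rewrite /edge0; case: u => [|c|x|x c|k|k] //=.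
  - case/orP => /eqP ->; first by exists (inl (inl (inl (inl (x, true))))).
    by exists (inl (inl (inl (inl (x, false))))).
  - case/orP => /eqP ->; first by exists (inl (inl (inr (x, c)))).
    by exists (inl (inl (inl (inr (x, c))))).
  - case/orP => /eqP ->; first by exists (inl (inr (k, true))).
    by exists (inl (inr (k, false))).
  - by move/eqP ->; exists (inr k).
case=> -[[[[[x c]|[x c]]|[x c]]|[k c]]|k] [-> ->] //=; rewrite /edge0 /= ?eqxx ?orbT //.
  by case: c; rewrite eqxx ?orbT.
by case: c.
Qed.

Lemma height_le_card (v : vertex) : (height v <= #|{: vertex}|)%N.
Proof.
rewrite card_vertex card_follower.
by case: v => [|c|x|x c|k|k] //=; try (have := lev_le x); lia.
Qed.

Section Value.
Variable b : follower -> bool.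

Definition wt (v : vertex) : rat := weight G (priority v).

Definition value (v : vertex) : rat :=
  \sum_(i < #|{: vertex}|)
    (if iter i (strat b) v != Top then wt (iter i (strat b) v) else 0).

Lemma iter_strat_top v k : (height v <= k)%N -> iter k (strat b) v = Top.
Proof.
elim: k v => [|k IH] v; first by case: v.
move=> hv; rewrite iterSr; have [->|vt] := eqVneq v Top.
  by apply: IH; rewrite /strat ffunE.
apply: IH; have /forallP/(_ v) := strat_strat0 b.
case: v hv vt => [|c|x|x c|k'|k'] // hv vt; try by rewrite /strat ffunE.
  by move=> /height_edge /(_ vt) h; rewrite -ltnS; apply: leq_trans h hv.
by move=> /height_edge /(_ vt) h; rewrite -ltnS; apply: leq_trans h hv.
Qed.

Lemma value_top : value Top = 0.
Proof. by apply: big1 => i _; rewrite iter_strat_top. Qed.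

Lemma value_rec v : v != Top -> value v = wt v + value (strat b v).
Proof.
move=> vt; rewrite /value.
have hv := height_le_card v.
have [M cM] : exists M, #|{: vertex}| = M.+1 by exists #|{: vertex}|.-1; rewrite card_vertex.
rewrite cM in hv *.
(* The first term is split off one sum and the last term off the other; the latter vanishes because
   the play has reached the sink by then. *)
rewrite big_ord_recl big_ord_recr /= vt; congr (_ + _).
have -> : iter M (strat b) (strat b v) = Top.
  by rewrite -iterSr iter_strat_top.
by rewrite eqxx addr0; apply: eq_bigr => i _; rewrite -iterSr.
Qed.

(** Player 1 owns only the [Base] vertices, whose single edge leads to the sink. *)
Lemma succE (t : {ffun vertex -> vertex}) :
  @strat1 G t -> @succ G (strat b) t =1 strat b.
Proof.
move=> st v; rewrite /succ /=; case: v => [|c|x|x c|k|k] //=.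
  by rewrite ffunE.
by rewrite (strat1E st) ffunE.
Qed.

Lemma valE (t : {ffun vertex -> vertex}) v :
  @strat1 G t -> @val G (strat b) t v = value v.
Proof.
move=> st; apply: eq_bigr => i _.
by rewrite (eq_iter (succE st)).
Qed.

Lemma improvingE u w :
  @improving G (strat b) u w = edge0 (u : V G) w && (value (strat b u) < value w).
Proof.
rewrite /improving; congr (_ && _); apply/existsP/idP.
  by case=> t /andP[/and3P[st _ _]]; rewrite !valE.
move=> lt_v; exists [ffun=> Top]; rewrite !valE ?top_strat1 // lt_v andbT.
apply/and3P; split; first exact: top_strat1.
  apply/forallP => v; rewrite /reaches (eq_iter (succE top_strat1)).
  by rewrite iter_strat_top // height_le_card.
apply/forallP => t'; apply/implyP => st'; apply/forallP => v; apply/implyP => _.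
by rewrite !valE ?top_strat1.
Qed.

(** Read off the strategy without valuations; [value_gap] shows that it names the vertex of larger
    value on each level, [true] standing for [v] and [false] for [u]. *)
Fixpoint better (i : nat) : bool :=
  if i is j.+1 then
    if insub j is Some k then
      (b (Real k true) == better j) && (b (Real k false) != better j)
    else false
  else false.

Lemma betterS (i : 'I_n) :
  better i.+1 = (b (Real i true) == better i) && (b (Real i false) != better i).
Proof. by rewrite /= valK. Qed.

Definition stale x : bool := b x != better (lev x).

(** Exactly one of [Mov x c] and [Chk x c] is active for all [x] and [c], which keeps the number of
    improving switches constant. *)
Definition active (a : item) : bool :=
  match a with
  | Mov x c => stale x && (c == better (lev x))
  | Chk x c => ~~ (stale x && (c == better (lev x)))
  | Gain _ => true
  end.

Local Notation base := ((#|{: vertex}|.-1)%:R : rat).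

Lemma base_ge2 : 2 <= base.
Proof. by rewrite ler_nat card_vertex; lia. Qed.

Lemma wtE v : wt v = match v with
  | Base false => base ^+ (n.+1).*2
  | Fol (Real i false) => base ^+ (n - i).*2
  | _ => 1 end.
Proof.
have evenN k : (- base) ^ Posz k.*2 = base ^+ k.*2.
  by rewrite -exprnP -mul2n !exprM sqrrN.
by rewrite /wt /weight; case: v => [|[]|[i []|i k|t]|x c|k|k] //=;
  rewrite ?evenN ?expr0z.
Qed.

Lemma value_Fol x : value (Fol x) = wt (Fol x) + value (pair (lev x) (b x)).
Proof. by rewrite value_rec // /strat ffunE. Qed.

Lemma value_Base c : value (Base c) = wt (Base c).
Proof. by rewrite value_rec // /strat ffunE value_top addr0. Qed.

Lemma basesq i : (i <= n)%N ->
  4 * base ^+ (n - i).*2 <= base ^+ (n.+1 - i).*2 /\ 1 <= base ^+ (n - i).*2.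
Proof.
move=> le_in; have b2 := base_ge2; have e1 : 1 <= base ^+ (n - i).*2.
  by rewrite exprn_ege1 //; lra.
split=> //; rewrite subSn // doubleS !exprS mulrA ler_wpM2r //; first lra.
by rewrite -[4]/(2 * 2 : rat) ler_pM.
Qed.

(** Induction on the level. With equal successors [u] wins on level [i + 1] by its weight minus 1,
    which is the bound. If only [v] points to the better vertex, the gap of level [i] is used: up to
    1 it is at least four times the weight of [u], so [v] wins by enough. If only [u] does, both
    advantages add up. *)
Lemma value_gap i : (i <= n)%N ->
  base ^+ (n.+1 - i).*2 - 1 <=
    value (pair i (better i)) - value (pair i (~~ better i)).
Proof.
elim: i => [|i IH] lt_in.
  by rewrite /pair /= !value_Base !wtE subn0.
have {IH} := IH (ltnW lt_in).
have [le4 ge1] := basesq (ltnW lt_in).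
rewrite -[i.+1]/((Ordinal lt_in).+1) betterS !pairS !value_Fol !wtE subSS /=.
case E1: (b (Real _ true)); case E2: (b (Real _ false));
  by case: (better i) => /=; rewrite ?E1 ?E2; lra.
Qed.

Lemma wt_Fol x : 0 < wt (Fol x) /\ wt (Fol x) < base ^+ (n.+1 - lev x).*2 - 1.
Proof.
have [le4 ge1] := basesq (lev_le x).
by rewrite wtE; case: x le4 ge1 => [i []|i t|t] /=; lra.
Qed.

(** The gap of a level exceeds the weight of a follower. Hence [Comp x c] gains by moving to [x]
    unless [x] points to the worse vertex while [c] is the better one. *)
Lemma improving_edge_of a :
  improving (G := G) (strat b) (edge_of a).1 (edge_of a).2 = active a.
Proof.
rewrite improvingE; case: a => [x c|x c|k] /=.
- have e0 : edge0 (Fol x : V G) (pair (lev x) c).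
    by rewrite /edge0 /=; case: c; rewrite eqxx ?orbT.
  rewrite e0 {e0} /= /strat ffunE /stale.
  have := value_gap (lev_le x); have [] := wt_Fol x.
  by case: (better _); case: (b x); case: c; rewrite ?ltxx ?eqxx //= => *;
     first [apply/idP; lra | apply/negbTE; rewrite -leNgt; lra].
- have e0 : edge0 (Comp x c : V G) (Fol x) by rewrite /edge0 /= eqxx orbT.
  rewrite e0 {e0} /= /strat ffunE /stale value_Fol.
  have := value_gap (lev_le x); have [] := wt_Fol x.
  by case: (better _); case: (b x); case: c; rewrite ?eqxx /= => *;
     first [apply/idP; lra | apply/negbTE; rewrite -leNgt; lra].
- by rewrite /edge0 /= /strat ffunE value_top value_Base wtE ltr01.
Qed.

Lemma improving_active u w :
  improving (G := G) (strat b) u w ->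
  exists2 a, active a & (u, w) = edge_of a.
Proof.
move=> imp; suff [a aE] : exists a, (u, w) = edge_of a.
  by exists a => //; rewrite -improving_edge_of -aE.
move: imp; rewrite improvingE /edge0 /=; case: u => [|c|x|x c|k|k] //=.
- by case/andP=> /orP[] /eqP -> _; [exists (Mov x true) | exists (Mov x false)].
- case/andP=> /orP[] /eqP ->; last by exists (Chk x c).
  by rewrite /strat ffunE ltxx.
- case/andP=> /orP[] /eqP ->; last by exists (Gain k).
  by rewrite /strat ffunE ltxx.
- by case/andP=> /eqP ->; rewrite /strat ffunE ltxx.
Qed.

End Value.

(** * The switch picked at a given rank *)

Section Selection.
Variable b : follower -> bool.

Local Notation act := (enum (active b)).

Lemma switches_perm :
  perm_eq (sorted_switches (G := G) (strat b)) (map edge_of act).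
Proof.
rewrite /sorted_switches perm_sort; apply: uniq_perm.
- exact: enum_uniq.
- by rewrite map_inj_uniq ?enum_uniq //; apply: edge_of_inj.
move=> [u w]; rewrite mem_enum inE /=; apply/idP/mapP.
  by case/improving_active => a aa eqa; exists a; rewrite ?mem_enum.
case=> a; rewrite mem_enum => aa eqa.
by have := improving_edge_of b a; rewrite -eqa /= => ->.
Qed.

Lemma size_switches :
  size (sorted_switches (G := G) (strat b)) = #|active b|.
Proof. by rewrite (perm_size switches_perm) size_map cardE. Qed.

Lemma card_active : #|active b| = (#|{: follower}| * 2 + C)%N.
Proof.
pose enc (y : follower * bool + 'I_C) : item :=
  match y with
  | inl (x, c) => if stale b x && (c == better b (lev x)) then Mov x c else Chk x c
  | inr k => Gain k end.
have enc_inj : injective enc.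
  move=> [[x c]|k] [[y d]|l] //=; try by case: ifP.
    by case: ifP => _; case: ifP => _ //= [-> ->].
  by move=> [->].
rewrite (@eq_card _ _ (mem (codom enc))).
  by rewrite card_codom // card_sum card_prod card_bool card_ord.
move=> a; rewrite [in LHS]unfold_in; apply/idP/codomP.
  case: a => [x c|x c|k] /= aa.
  - by exists (inl (x, c)); rewrite /= aa.
  - by exists (inl (x, c)); rewrite /= (negbTE aa).
  - by exists (inr k).
by case=> -[[x c]|k] -> //=; case: ifP => //= ->.
Qed.

(** As no other active item shares the key of [a], everything before [edge_of a] in the sorted list
    has a smaller key and nothing behind it has; ties among other items do no harm. *)
Lemma nth_switches a e0 : active b a ->
  (forall a', active b a' -> a' != a -> key a' != key a) ->
  nth e0 (sorted_switches (G := G) (strat b))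
    (count (fun a' => key a' < key a) act) = edge_of a.
Proof.
move=> aa neq_key; set s := sorted_switches _.
pose leT := fun e f : V G * V G => (g_bland e.1 e.2 <= g_bland f.1 f.2)%N.
have srt : sorted leT s by apply: sort_sorted => x y; apply: leq_total.
have tr : transitive leT by move=> x y z; apply: leq_trans.
have in_s : edge_of a \in s.
  by rewrite (perm_mem switches_perm) map_f // mem_enum.
have us : uniq s by rewrite (perm_uniq switches_perm) map_inj_uniq ?enum_uniq //; apply: edge_of_inj.
suff -> : count (fun a' => key a' < key a) act = index (edge_of a) s by rewrite nth_index.
have -> : count (fun a' => key a' < key a) act =
          count (fun e => edge_key key e < key a) (map edge_of act).
  by rewrite count_map; apply: eq_count => a' /=; rewrite edge_key_of.
rewrite -(permP switches_perm) -/s.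
have keyE e : e \in s -> e != edge_of a -> edge_key key e != key a.
  rewrite (perm_mem switches_perm) => /mapP[a']; rewrite mem_enum => aa' ->.
  by rewrite (inj_eq edge_of_inj) edge_key_of; apply: neq_key.
case/splitPr: in_s srt us keyE => s1 s2.
rewrite (sorted_pairwise tr) pairwise_cat /= cat_uniq /= negb_or.
case/and3P => /allrelP le12 _ /andP[/allP le2 _] /and3P[_ /andP[e1 _] /andP[e2 _]] keyE.
rewrite index_cat (negbTE e1) /= eqxx addn0 count_cat /= edge_key_of ltxx add0n.
have -> : count (fun e => edge_key key e < key a) s2 = 0%N.
  apply/eqP; rewrite -leqn0 leqNgt -has_count; apply/hasPn => e es2.
  rewrite -leNgt leNgt -(edge_key_of key a); apply/negP.
  case: e es2 => u w es2; rewrite [edge_of a]surjective_pairing => /bland_lt.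
  by rewrite ltnNge; have := le2 _ es2; rewrite /leT /= => ->.
rewrite addn0; apply/eqP; rewrite -all_count; apply/allP => e es1.
have ne : e != edge_of a by apply: contraNneq e1 => <-.
have := keyE e; rewrite mem_cat es1 => /(_ isT ne); rewrite lt_neqAle => -> /=.
rewrite leNgt -(edge_key_of key a); apply/negP.
case: e es1 {ne} => u w es1; rewrite [edge_of a]surjective_pairing => /bland_lt.
by rewrite ltnNge; have := le12 _ _ es1 (mem_head _ _); rewrite /leT /= => ->.
Qed.

Lemma apply_switch_flip x c : c != b x ->
  apply_switch (G := G) (strat b) (edge_of (Mov x c)) = strat (flip b x).
Proof.
move=> cb; apply/ffunP => v; rewrite !ffunE /=.
case: v => [|c'|y|y c'|k|k] //=; rewrite /flip.
have -> : (Fol y == Fol x :> vertex) = (y == x) by apply/eqP/eqP => [[]|->].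
by case: eqP => // ->; congr (pair _ _); case: c cb; case: (b x).
Qed.

Lemma si_step_mov P x c h : active b (Mov x c) ->
  (forall a', active b a' -> a' != Mov x c -> key a' != key (Mov x c)) ->
  (P (#|{: follower}| * 2 + C)%N (num_edges0 G) h).1 =
    (count (fun a' => key a' < key (Mov x c)) act).+1 ->
  si_step (G := G) P (strat b, h) =
    (strat (flip b x), (P (#|{: follower}| * 2 + C)%N (num_edges0 G) h).2).
Proof.
move=> aa kd pE; rewrite /si_step.
have := size_switches; case S : (sorted_switches _) => [|e0 s'] sz.
  suff : (0 < #|active b|)%N by rewrite -sz.
  by apply/card_gt0P; exists (Mov x c).
rewrite -S in sz *; rewrite sz card_active pE /= nth_switches //.
rewrite apply_switch_flip //; move: aa => /= /andP[st /eqP ->].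
by rewrite eq_sym.
Qed.
End Selection.

End Fixed.
End Game.

(** * The counter *)

Arguments better : simpl never.
Section Dynamics.
Variables (n K T : nat).
Local Notation follower := (follower n K T).
Implicit Types (b : follower -> bool) (x y : follower).

Lemma better_stale b (i : 'I_n) :
  better b i.+1 = ~~ stale b (Real i true) && stale b (Real i false).
Proof. by rewrite betterS /stale negbK. Qed.

Lemma better_out b i : (n < i)%N -> better b i = false.
Proof. by case: i => // i le_ni; rewrite /better insubN // -leqNgt -ltnS. Qed.

Definition is_real x : bool := if x is Real _ _ then true else false.

Lemma better_flip_filler b x : ~~ is_real x -> better (flip b x) =1 better b.
Proof.
move=> nx; elim=> // i IH; have [lt_in|le_ni] := ltnP i n; last by rewrite !better_out.
rewrite -[i.+1]/((Ordinal lt_in).+1) !betterS /= !IH /flip.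
by case: x nx {IH}.
Qed.

Lemma stale_flip_filler b x y : ~~ is_real x ->
  stale (flip b x) y = stale b y (+) (y == x).
Proof.
move=> nx; rewrite /stale better_flip_filler // /flip.
by case: (y == x); case: (b y); case: (better _ _).
Qed.

(** The first hypothesis says that [v] is flipped if stale, and [u] otherwise. Either way the better
    vertex of level [j + 1] changes, which toggles all followers there. The change stops at that
    level: the reals of index [j + 1] both point to the same vertex, so [u] is better above them
    before and after. *)
Lemma stale_flip_real b (j : 'I_n) c y :
  stale b (Real j true) = c -> stale b (Real j false) ->
  (forall (k : 'I_n) d, (j < k)%N -> ~~ stale b (Real k d)) ->
  stale (flip b (Real j c)) y = stale b y (+) ((lev y == j.+1) || (y == Real j c)).
Proof.
move=> st sf above; pose b' := flip b (Real j c); rewrite -/b'.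
have flipE z : b' z = b z (+) (z == Real j c).
  by rewrite /b' /flip; case: eqP; rewrite ?addbT ?addbF.
have le_j i : (i <= j)%N -> better b' i = better b i.
  elim: i => // i IH lt_ij; have lt_in := ltn_trans lt_ij (ltn_ord j).
  rewrite -[i.+1]/((Ordinal lt_in).+1) !betterS /= !IH 1?ltnW // !flipE.
  have ne d : (Real (Ordinal lt_in) d == Real j c :> follower) = false.
    by apply/eqP => -[/(congr1 (@nat_of_ord n))] /= ij; rewrite ij ltnn in lt_ij.
  by rewrite !ne !addbF.
have at_j : better b' j.+1 = ~~ better b j.+1.
  rewrite !betterS le_j // !flipE; move: st sf; rewrite /stale /=.
  have -> : (Real j true == Real j c :> follower) = c by apply/eqP/idP => [[]//|->].
  have -> : (Real j false == Real j c :> follower) = ~~ c by apply/eqP/idP => [[<-//]|/negbTE ->].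
  by case: (c); case: (b _); case: (b _); case: (better b j).
have gt_j i : (j.+1 < i)%N -> better b' i = better b i.
  case: i => // i lt_ji; have [lt_in|le_ni] := ltnP i n; last by rewrite !better_out.
  elim: i lt_ji lt_in => // i IH lt_ji lt_in.
  have ne d : (Real (Ordinal lt_in) d == Real j c :> follower) = false.
    by apply/eqP => -[/(congr1 (@nat_of_ord n))] /=; lia.
  have [ij|ne_ij] := eqVneq i j.
    set k := Ordinal lt_in in ne *.
    have ab d : b (Real k d) = better b j.+1.
      have := above k d; rewrite [nat_of_ord k]/= ij => /(_ (ltnSn j)).
      by rewrite /stale /= ij negbK => /eqP.
    rewrite -[i.+2]/(k.+1) !betterS !flipE !ne !addbF !ab.
    by rewrite -[nat_of_ord k]/(i.+1) ij at_j; case: (better b j.+1).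
  have lt' : (j.+1 < i.+1)%N by lia.
  rewrite -[i.+2]/((Ordinal lt_in).+1) !betterS !flipE !ne !addbF.
  by rewrite /= IH // ltnW.
rewrite /stale flipE; have [lj|ne_lj] /= := eqVneq (lev y) j.+1.
  have -> : (y == Real j c :> follower) = false.
    by apply/eqP => yE; move: lj; rewrite yE /= => /eqP; rewrite eqn_leq ltnn andbF.
  by rewrite lj at_j addbF; case: (b y); case: (better _ _).
have -> : better b' (lev y) = better b (lev y).
  have [le_lj|lt_jl] := leqP (lev y) j; first exact: le_j.
  by apply: gt_j; rewrite ltn_neqAle eq_sym ne_lj.
by case: (y == _); case: (b y); case: (better _ _).
Qed.

(** The followers of level [i] are reacting to the last change of its better vertex: [t] of the
    fillers have done so, and [s] transient followers are used up. The [u] vertices of index below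
    [i] stay unspecified, since they hold the pending work of the counter. *)
Record phase (i : 'I_n.+1) (t s : nat) b : Prop := Phase {
  phase_filler : forall j (k : 'I_K), stale b (Filler j k) = (j == i) && (t <= k)%N;
  phase_tran : forall k : 'I_T, stale b (Tran k) = (s <= k)%N;
  phase_v : forall j : 'I_n, stale b (Real j true) = (j == i :> nat);
  phase_u : forall j : 'I_n, (i <= j)%N -> stale b (Real j false) = (j == i :> nat) }.

Lemma phase_flip_filler i (t : 'I_K) s b :
  phase i t s b -> phase i t.+1 s (flip b (Filler i t)).
Proof.
case=> pf pt pv pu; split.
- move=> j k; rewrite stale_flip_filler // pf.
  have -> : (Filler j k == Filler i t :> follower) = (j == i) && (k == t).
    by apply/eqP/andP => [[-> ->]|[/eqP -> /eqP ->]]; rewrite ?eqxx.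
  have [_|//] := eqVneq j i; rewrite /= -val_eqE /=.
  by case: (ltngtP t k).
- by move=> k; rewrite stale_flip_filler // pt addbF.
- by move=> j; rewrite stale_flip_filler // pv addbF.
- by move=> j ij; rewrite stale_flip_filler // pu // addbF.
Qed.

Lemma phase_flip_tran i t (s : 'I_T) b :
  phase i t s b -> phase i t s.+1 (flip b (Tran s)).
Proof.
case=> pf pt pv pu; split.
- by move=> j k; rewrite stale_flip_filler // pf addbF.
- move=> k; rewrite stale_flip_filler // pt.
  have -> : (Tran k == Tran s :> follower) = (k == s).
    by apply/eqP/eqP => [[->]|->].
  by rewrite -val_eqE /=; case: (ltngtP s k).
- by move=> j; rewrite stale_flip_filler // pv addbF.
- by move=> j ij; rewrite stale_flip_filler // pu // addbF.
Qed.

(** The number of counter switches still to come: a stale real of index [i] causes its own switch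
    and, by the change it produces, those caused by both reals of index [i + 1], hence
    [2 ^ (n - i) - 1] in total. *)
Definition potential b : nat :=
  \sum_(i < n) (stale b (Real i true) + stale b (Real i false)) * (2 ^ (n - i)).-1.

Record next_real b (j : 'I_n) (c : bool) : Prop := NextReal {
  next_v : stale b (Real j true) = c;
  next_u : stale b (Real j false);
  next_above : forall (k : 'I_n) d, (j < k)%N -> ~~ stale b (Real k d);
  next_v' : forall k : 'I_n, k != j -> ~~ stale b (Real k true) }.

(** For [i < n] both reals of index [i] are stale and [v] goes first. For [i = n] no [v] is stale,
    and the highest stale [u], which exists by positive potential, is next. *)
Lemma next_real_ex i b : phase i K T b -> (0 < potential b)%N ->
  exists j c, next_real b j c.
Proof.
case=> pf pt pv pu pot; have [lt_in|le_ni] := ltnP i n.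
  exists (Ordinal lt_in), true; split.
  - by rewrite pv /= eqxx.
  - by rewrite pu /= ?eqxx.
  - by move=> k [] /= ik; rewrite ?pv ?pu ?(ltnW ik) // gtn_eqF.
  - by move=> k; rewrite pv -val_eqE.
have v0 k : stale b (Real k true) = false.
  by rewrite pv ltn_eqF // (leq_trans (ltn_ord k)).
have /existsP[j0 st0] : [exists j : 'I_n, stale b (Real j false)].
  apply: contraLR pot; rewrite negb_exists => /forallP fr.
  by rewrite lt0n negbK /potential big1 // => k _; rewrite v0 (negbTE (fr k)).
case: (@arg_maxnP _ j0 (fun j => stale b (Real j false)) (@nat_of_ord n) st0) => j sj maxj.
exists j, false; split=> // [k [] jk|k _]; rewrite ?v0 //.
by apply: contraL jk => /maxj; rewrite -leqNgt.
Qed.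

Lemma phase_flip_real i b j c : phase i K T b -> next_real b j c ->
  phase (lift ord0 j) 0 T (flip b (Real j c)).
Proof.
case=> pf pt pv pu [st sf above v0]; have E := stale_flip_real _ st sf above.
split=> [k t|k|k|k]; rewrite E /=.
- by rewrite pf leqNgt ltn_ord andbF /= orbF andbT -val_eqE.
- by rewrite pt leqNgt ltn_ord.
- rewrite /bump /= add1n; have [->|ne_kj] := eqVneq k j.
    have -> : (Real j true == Real j c :> follower) = c by apply/eqP/idP => [[]//|->].
    by rewrite st ltn_eqF // addbb.
  rewrite (negbTE (v0 _ ne_kj)).
  have -> : (Real k true == Real j c :> follower) = false.
    by apply/eqP => -[kj _]; rewrite kj eqxx in ne_kj.
  by rewrite orbF.
rewrite /bump add1n => jk; rewrite (negbTE (above _ _ jk)) /=.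
have -> : (Real k false == Real j c :> follower) = false.
  by apply/eqP => -[kj _]; rewrite kj ltnn in jk.
by rewrite orbF.
Qed.

Lemma potential_flip_real b j c : next_real b j c ->
  potential b = (potential (flip b (Real j c))).+1.
Proof.
case=> st sf above v0; have E := stale_flip_real _ st sf above.
rewrite /potential (bigD1 j) // [in RHS](bigD1 j) //= !E /=.
have -> : (Real j true == Real j c :> follower) = c by apply/eqP/idP => [[]//|->].
have -> : (Real j false == Real j c :> follower) = ~~ c.
  by apply/eqP/idP => [[<-//]|/negbTE ->].
rewrite ltn_eqF // !orFb st sf.
have E' (k : 'I_n) d : k != j ->
    stale (flip b (Real j c)) (Real k d) = stale b (Real k d) (+) (k == j.+1 :> nat).
  move=> kj; rewrite E /=.
  have -> : (Real k d == Real j c :> follower) = false.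
    by apply/eqP => -[kj' _]; rewrite kj' eqxx in kj.
  by rewrite orbF.
have p2 k : (0 < 2 ^ k)%N by rewrite expn_gt0.
have [lt_jn|le_nj] := ltnP j.+1 n.
  pose j' := Ordinal lt_jn.
  have ne_j : j' != j by rewrite -val_eqE /= gtn_eqF.
  rewrite (bigD1 j') // [in RHS](bigD1 j') //= !E' // eqxx.
  rewrite (negbTE (above j' true _)) //= (negbTE (above j' false _)) //=.
  set S := (\sum_(i < n | _) _)%N; set S' := (\sum_(i < n | _) _)%N.
  have -> : S' = S.
    apply: eq_bigr => k /andP[kj kj']; rewrite !E' //.
    have -> : (k == j.+1 :> nat) = false by apply/negbTE.
    by rewrite !addbF.
  have -> : (n - j = (n - j.+1).+1)%N by rewrite subnSK // ltnW.
  rewrite expnS; have := p2 (n - j.+1)%N.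
  by case: (c) => /=; lia.
set S := (\sum_(i < n | _) _)%N; set S' := (\sum_(i < n | _) _)%N.
have -> : S' = S.
  apply: eq_bigr => k kj; rewrite !E' //.
  have -> : (k == j.+1 :> nat) = false by rewrite ltn_eqF // (leq_trans _ le_nj).
  by rewrite !addbF.
have -> : (n - j = 1)%N by have := ltn_ord j; lia.
by case: (c) => /=; lia.
Qed.

(** On every level [u] is better; the followers of level 0 all point to the wrong vertex, the others
    all to the right one. *)
Definition start x : bool := lev x == 0.

Lemma stale_start x : stale start x = (lev x == 0).
Proof.
have bE i : better start i = false.
  elim: i => // i IH; have [lt_in|le_ni] := ltnP i n; last by rewrite better_out.
  by rewrite -[i.+1]/((Ordinal lt_in).+1) betterS IH /start /=; case: (i == 0).
by rewrite /stale bE /start; case: (lev x == 0).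
Qed.

Lemma phase_start : phase ord0 0 0 start.
Proof.
split=> [j k|k|j|j _]; rewrite stale_start //=.
by rewrite andbT -val_eqE.
Qed.

Lemma potential_start : (0 < n)%N -> potential start = (2 * (2 ^ n).-1)%N.
Proof.
move=> n0; rewrite /potential (bigD1 (Ordinal n0)) // !stale_start /= subn0.
rewrite big1 ?addn0 // => k kj; rewrite !stale_start /=.
by rewrite -[_ == 0]/(k == Ordinal n0) (negbTE kj).
Qed.

End Dynamics.

(** * Bland numbers *)

Lemma dense_avoid (Z : seq rat) (u v : rat) : u < v ->
  exists y, [/\ u < y, y < v & y \notin Z].
Proof.
elim: Z v => [|z Z IH] v lt_uv; first by exists ((u + v) / 2); split=> //; lra.
pose v' := if (u < z) && (z < v) then z else v.
have [lt_uv' le_v'v] : u < v' /\ v' <= v.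
  by rewrite /v'; case: ifP => // /andP[-> /ltW].
have [y [uy yv yZ]] := IH _ lt_uv'; exists y; split=> //; first exact: lt_le_trans yv _.
rewrite inE negb_or yZ andbT; apply/eqP => yz; move: yv; rewrite /v' -yz uy /=.
case: ifP => [|/negbT]; first by rewrite ltxx.
by rewrite -leNgt => /le_lt_trans h /h; rewrite ltxx.
Qed.

(** * Inserting a key of prescribed rank *)

Section InsertKey.
Variables (I : finType) (A : pred I) (f : I -> rat) (lo hi : rat).
Hypothesis (lo_hi : lo < hi) (f_inj : {in A &, injective f}).
Hypothesis (f_in : forall a, A a -> lo < f a < hi).

Lemma gap_above u : u < hi ->
  exists v, [/\ u < v, v <= hi & forall a, A a -> u < f a -> v <= f a].
Proof.
move=> lt_u; case: (pickP [pred a | A a & u < f a]) => [a0 a0P|none].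
  case: (arg_minP f a0P) => a /andP[Aa ua] mina; exists (f a).
  split=> // [|a' Aa' ua']; last by apply: mina; rewrite /= Aa'.
  by have /andP[_ /ltW] := f_in Aa.
by exists hi; split=> // a Aa ua; have := none a; rewrite /= Aa ua.
Qed.

(** Induction on [k]: starting from a point with [k] keys below it that differs from all keys, step
    just past the least key [a0] above it, so that exactly one key is passed. *)
Lemma insert_key (Z : seq rat) k : (k <= #|A|)%N ->
  exists y, [/\ lo < y, y < hi, y \notin Z & #|[pred a | A a & f a < y]| = k].
Proof.
elim: k Z => [|k IH] Z le_k.
  have [v [lo_v v_hi vP]] := gap_above lo_hi.
  have [y [loy yv yZ]] := dense_avoid Z lo_v; exists y; split=> //.
    exact: lt_le_trans yv _.
  apply: eq_card0 => a; rewrite !inE; apply/negP => /andP[Aa fay].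
  have /andP[lofa _] := f_in Aa.
  by have := lt_trans fay (lt_le_trans yv (vP _ Aa lofa)); rewrite ltxx.
have [y [loy yhi yZ cy]] := IH (map f (enum I)) (ltnW le_k).
have yf a : f a != y by apply: contraNneq yZ => <-; rewrite map_f ?mem_enum.
have [a1 /andP[Aa1 ya1]] : exists a, A a && (y < f a).
  apply/existsP; apply: contraLR le_k; rewrite negb_exists => /forallP no.
  rewrite -ltnNge ltnS -cy; apply/subset_leq_card/subsetP => a Aa; rewrite !inE.
  have := no a; rewrite -[A a]/(a \in A) Aa /= -leNgt lt_neqAle yf => ->.
  by rewrite andbT.
case: (arg_minP f (P := [pred a | A a & y < f a]) (i0 := a1)).
  by rewrite /= Aa1.
move=> a0 /andP[Aa0 ya0] mina0; have /andP[lo0 hi0] := f_in Aa0.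
have [v [a0v v_hi vP]] := gap_above hi0.
have [y' [ay' yv' yZ']] := dense_avoid Z a0v; exists y'; split=> //.
- exact: lt_trans ay'.
- exact: lt_le_trans v_hi.
rewrite -cy (cardD1 a0) !inE Aa0 ay' add1n; congr _.+1.
apply: eq_card => a; rewrite !inE; have [->|ne] /= := eqVneq a a0.
  by rewrite ltNge (ltW ya0) andbF.
case Aa: (A a) => //=; apply/idP/idP => [lt_y'|lt_y]; last first.
  exact: lt_trans lt_y (lt_trans ya0 ay').
have le_a0 : f a <= f a0.
  rewrite leNgt; apply/negP => /(vP _ Aa) vfa.
  by have := lt_trans lt_y' (lt_le_trans yv' vfa); rewrite ltxx.
rewrite lt_neqAle yf leNgt; apply/negP => yfa.
have := mina0 a; rewrite /= Aa yfa => /(_ isT) le_0a.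
have : f a = f a0 by apply/eqP; rewrite eq_le le_a0.
by move/(f_inj Aa Aa0) => aE; rewrite aE eqxx in ne.
Qed.
End InsertKey.

Section Sums.
Variables (n K T C : nat).
Local Notation follower := (follower n K T).
Local Notation item := (item n K T C).

Lemma sum_follower (f : follower -> nat) :
  (\sum_x f x = \sum_i \sum_c f (Real i c) + \sum_i \sum_t f (Filler i t)
    + \sum_s f (Tran s))%N.
Proof.
rewrite (reindex (@follower_decode n K T)) /=; last first.
  exists (@follower_code n K T) => [y _|x _]; last exact: follower_codeK.
  by case: y => [[[]|[]]|].
rewrite !big_sumType /= !pair_big /=.
by congr (_ + _ + _)%N; apply: eq_bigr => -[].
Qed.

Lemma sum_item (f : item -> nat) :
  (\sum_a f a = \sum_x \sum_c (f (Mov x c) + f (Chk x c)) + \sum_k f (Gain k))%N.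
Proof.
rewrite (reindex (@item_decode n K T C)) /=; last first.
  exists (@item_code n K T C) => [y _|a _]; last exact: item_codeK.
  by case: y => [[[]|[]]|].
rewrite !big_sumType /= !pair_big /= big_split /=.
by congr (_ + _ + _)%N; apply: eq_bigr => -[].
Qed.

Lemma card_sum_nat (I : finType) (A : pred I) : #|A| = (\sum_a A a)%N.
Proof. by rewrite -sum1_card big_mkcond; apply: eq_bigr => a _; rewrite unfold_in; case: (A a). Qed.
End Sums.

(** * Arranging the items around the window *)

Section Arrange.
Variables (n K T C : nat).
Local Notation follower := (follower n K T).
Local Notation item := (item n K T C).
Variables (x : nat -> nat) (r : nat) (lc : nat -> bool) (CL : nat).

(* The [t]-th filler of each phase is picked at rank [x t], the counter switch at
   rank [r].  The window of the counter switches separates left from right;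
   [lc t] tells that the [Chk] items of the [t]-th fillers are placed on the left,
   and [CL] of the always improving items are.  [drift t] is the distance from
   [r] to the window once [t] fillers are consumed. *)
Definition left t : bool := (x t <= r)%N.
Definition nleft : nat := (CL + n.+1 * (\sum_(t < K) lc t) * 2)%N.
Definition drift t : nat := (\sum_(k < K) [&& left k, ~~ lc k & (t <= k)])%N.

Definition on_left (a : item) : bool :=
  match a with
  | Mov (Filler _ t) _ => left t | Chk (Filler _ t) _ => lc t
  | Gain k => (k < CL)%N | _ => false
  end.

Definition in_region (a : item) : bool :=
  match a with Mov (Real _ _) _ | Chk (Real _ _) _ => true | _ => false end.

(* Activity of the items outside the region, as dictated by the phase alone. *)
Definition phase_active (i : 'I_n.+1) (c : bool) (t : nat) (a : item) : bool :=
  match a with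
  | Mov (Filler j k) d => [&& j == i, (t <= k)%N & d == c]
  | Chk (Filler j k) d => ~~ [&& j == i, (t <= k)%N & d == c]
  | Chk (Tran _) _ | Gain _ => true
  | _ => false
  end.

Lemma phase_activeE i t b a : phase i t T b -> ~~ in_region a ->
  active b a = phase_active i (better b i) t a.
Proof.
case=> pf pt _ _; case: a => [[j d|j k|s] c|[j d|j k|s] c|k] //= _.
- by rewrite pf; have [->|] := eqVneq j i; rewrite //= andbA.
- by rewrite pt leqNgt ltn_ord.
- by rewrite pf; have [->|] := eqVneq j i; rewrite //= andbA.
- by rewrite pt leqNgt ltn_ord.
Qed.

Lemma active_region b : #|[pred a : item | active b a & in_region a]| = (n * 4)%N.
Proof.
rewrite card_sum_nat sum_item sum_follower /=.
rewrite [X in (_ + X)%N]big1 // addn0 [X in (_ + X)%N]big1 ?addn0; last first.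
  by move=> k _; rewrite big1 // => d _; rewrite ?andbF.
rewrite [X in (_ + X)%N]big1 ?addn0; last first.
  by move=> i _; rewrite big1 // => k _; rewrite big1 // => d _; rewrite ?andbF.
rewrite (eq_bigr (fun=> 4)%N) => [|i _]; first by rewrite sum_nat_const card_ord.
rewrite (eq_bigr (fun=> 2)%N) => [|c _]; first by rewrite sum_nat_const card_bool.
rewrite (eq_bigr (fun=> 1)%N) => [|d _]; first by rewrite sum_nat_const card_bool.
by rewrite /= !andbT; case: (_ && _).
Qed.

Lemma card_phase_active i c t : #|phase_active i c t| = (n.+1 * K * 2 + T * 2 + C)%N.
Proof.
rewrite card_sum_nat sum_item sum_follower /=.
rewrite [X in (X + _ + _ + _)%N]big1; last by move=> j _; rewrite big1 // => d _; rewrite big1.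
rewrite add0n (eq_bigr (fun=> K * 2)%N) => [|j _]; last first.
  rewrite (eq_bigr (fun=> 2)%N) => [|k _]; first by rewrite sum_nat_const card_ord.
  rewrite (eq_bigr (fun=> 1)%N) => [|d _]; first by rewrite sum_nat_const card_bool.
  by case: [&& _, _ & _].
rewrite sum_nat_const card_ord [in X in (_ + X + _)%N](eq_bigr (fun=> 2)%N) => [|k _]; last first.
  by rewrite sum_nat_const card_bool.
by rewrite sum_nat_const card_ord sum_nat_const card_ord muln1 mulnA.
Qed.

Hypothesis CL_le : (CL <= C)%N.
Hypothesis lc_lt : forall t, lc t -> (x t < r)%N.

Lemma lc_left t : lc t -> left t.
Proof. by move/lc_lt/ltnW. Qed.

Lemma sum_lt_ord m k : (k <= m)%N -> (\sum_(i < m) (i < k) = k)%N.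
Proof.
move=> le_km; rewrite -[RHS]card_ord -sum1_card (big_ord_widen m (fun=> 1%N)) //.
by rewrite [RHS]big_mkcond; apply: eq_bigr => i _; case: ltnP.
Qed.

(** If [lc k] holds, both [Mov] and [Chk] of a filler lie on the left and exactly one of them is
    active, a constant contribution. If only [left k] holds, the filler counts while it is
    improving; this is the drift. *)
Lemma card_phase_left i c t :
  #|[pred a | phase_active i c t a & on_left a]| = (nleft + drift t)%N.
Proof.
rewrite card_sum_nat sum_item sum_follower /=.
rewrite [X in (X + _ + _ + _)%N]big1; last by move=> j _; rewrite big1 // => d _; rewrite big1.
rewrite [X in (_ + X + _)%N]big1; last by move=> j _; rewrite big1.
rewrite sum_lt_ord // add0n addn0 /nleft [LHS]addnC -[RHS]addnA; congr (_ + _)%N.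
under eq_bigr => j _.
  under eq_bigr => k _.
    rewrite (eq_bigr (fun d : bool => lc k + (d == c) * ((j == i) * [&& left k, ~~ lc k & (t <= k)]))%N); last first.
      move=> d _; case: (j == i); case: (t <= k)%N; case: (d == c) => /=;
        by have := @lc_left k; case: (lc k) => [/(_ isT) ->|_]; case: (left k).
    rewrite big_split /= sum_nat_const card_bool -big_distrl /=.
    rewrite (bigD1 c) //= eqxx big1 ?addn0 ?mul1n; last by move=> d /negbTE ->.
    over.
  rewrite big_split /= -!big_distrr /=.
  over.
rewrite big_split /= sum_nat_const card_ord -big_distrl /= -/(drift t).
have -> : (\sum_(j < n.+1) (j == i) = 1)%N.
  by rewrite (bigD1 i) //= eqxx big1 // => j /negbTE ->.
by rewrite mul1n [(2 * _)%N]mulnC mulnA.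
Qed.

Local Notation big := (#|{: item}|%:R + 1 : rat).
Local Notation bnd := ((n * 2 + #|{: item}|)%:R : rat).
Definition rk (a : item) : rat := (enum_rank a : nat)%:R.

Lemma rk_bounds a : 0 <= rk a /\ rk a <= big - 2.
Proof.
rewrite /rk; split; first exact: ler0n.
have : ((enum_rank a).+1%:R <= #|{: item}|%:R :> rat) by rewrite ler_nat.
by rewrite -natr1; lra.
Qed.

Lemma rk_inj : injective rk.
Proof. by move=> a b /eqP; rewrite eqr_nat => /eqP /val_inj /enum_rank_inj. Qed.

(* Keys are negative on the left, in [[0, bnd)] in the window, and at least [bnd]
   on the right; the keys of the fillers are not used. *)
Definition static_key (a : item) : rat :=
  match a with
  | Mov (Real i c) _ => ((n - i.+1) * 2 + ~~ c)%:R
  | Chk (Real _ _) _ => (n * 2)%:R + rk a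
  | _ => if on_left a then - 1 - rk a else bnd + rk a
  end.

Lemma static_left a : on_left a -> static_key a = - 1 - rk a.
Proof. by case: a => [[j d|j k|s] c|[j d|j k|s] c|k] //= ->. Qed.

Lemma static_right a : ~~ on_left a -> ~~ in_region a -> static_key a = bnd + rk a.
Proof. by case: a => [[j d|j k|s] c|[j d|j k|s] c|k] //= /negbTE ->. Qed.

Lemma static_region a : in_region a -> 0 <= static_key a /\ static_key a <= bnd - 1.
Proof.
rewrite natrD; case: a => [[j d|j k|s] c|[j d|j k|s] c|k] //= _; last first.
  by have := ler0n rat (n * 2); have := rk_bounds (Chk (Real j d) c); lra.
split; first exact: ler0n.
have h : ((n - j.+1) * 2 + ~~ d)%:R + 1 <= (n * 2)%:R :> rat.
  by rewrite natr1 ler_nat; have := ltn_ord j; case: d => /=; lia.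
have := rk_bounds (Mov (Real j d) c : item); lra.
Qed.

Definition is_filler (a : item) : bool := if a is Mov (Filler _ _) _ then true else false.

Definition partial_key (phi : nat -> rat) (a : item) : rat :=
  if a is Mov (Filler _ k) _ then phi k else static_key a.

(** Open intervals for filler keys with room around the static keys of their side. They avoid the
    interval from 0 to [bnd - 1], which contains all keys of the window. *)
Definition bounds (l : bool) : rat * rat :=
  if l then (- big, 0) else (bnd - 1, bnd + big).

Definition target t : nat :=
  if left t then (x t).-1 else ((x t).-1 - (nleft + drift t + n * 4))%N.

(** Once filler [t] is due, only later fillers are still improving, so its rank involves their keys
    only. This is what allows the backward induction in [filler_keys]. *)
Record filler_ok i c (phi : nat -> rat) (t : 'I_K) : Prop := FillerOk {
  fok_bounds : (bounds (left t)).1 < phi t < (bounds (left t)).2;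
  fok_static : forall a, static_key a != phi t;
  fok_later : forall k : 'I_K, (t < k)%N -> phi k != phi t;
  fok_rank : #|[pred a | [&& phase_active i c t a, a != Mov (Filler i t) c,
                  on_left a == left t & partial_key phi a < phi t]]| = target t }.

Hypothesis nleft_r : nleft.+1 = r.
Hypothesis gap : forall t, (t < K)%N -> (x t <= r)%N || (r + n * 4 + drift 0 <= x t)%N.
Hypothesis x_pos : forall t, (0 < x t)%N.
Hypothesis x_le : forall t, (x t <= n * 4 + n.+1 * K * 2 + T * 2 + C)%N.

Lemma drift_le t : (drift t <= drift 0)%N.
Proof. by apply: leq_sum => k _; rewrite leq0n; case: (left k); case: (lc k); case: (t <= k)%N. Qed.

Lemma drift_gt0 (t : 'I_K) : left t -> ~~ lc t -> (0 < drift t)%N.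
Proof. by move=> lt nlc; rewrite /drift (bigD1 t) //= lt nlc leqnn. Qed.

Lemma target_le i c (t : 'I_K) :
  (target t <= #|[pred a | [&& phase_active i c t a, a != Mov (Filler i t) c &
                    on_left a == left t]]|)%N.
Proof.
set e : item := Mov (Filler i t) c.
have pe : phase_active i c t e by rewrite /= !eqxx leqnn.
have cl := card_phase_left i c t.
have ct := card_phase_active i c t.
have cr : #|[pred a | phase_active i c t a & ~~ on_left a]| =
    (n.+1 * K * 2 + T * 2 + C - (nleft + drift t))%N.
  rewrite -ct -cl -(cardID [pred a | on_left a] (phase_active i c t)).
  rewrite (@eq_card _ [predI _ & _] [pred a | phase_active i c t a & on_left a]).
    rewrite addKn; apply: eq_card => a; rewrite !inE andbC; congr (_ && _).
  by move=> a; rewrite !inE; congr (_ && _).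
have cE : #|[pred a | phase_active i c t a & on_left a == left t]| =
  (#|[pred a | [&& phase_active i c t a, a != e & on_left a == left t]]|).+1.
  rewrite (cardD1 e) !inE pe /= eqxx add1n; congr _.+1.
  by apply: eq_card => a; rewrite !inE andbCA.
rewrite -ltnS -cE /target; have g := gap (ltn_ord t); have xp := x_pos t.
have xl := x_le t; have dl := drift_le t.
have [lt|rt] := boolP (left t); last first.
  rewrite (@eq_card _ _ [pred a | phase_active i c t a & ~~ on_left a]); last first.
    by move=> a; rewrite !inE; case: on_left.
  by rewrite cr; move: g rt; rewrite /left => /orP[->//|]; lia.
rewrite (@eq_card _ _ [pred a | phase_active i c t a & on_left a]); last first.
  by move=> a; rewrite !inE; case: on_left.
(* The tight case is [x t = r], where the target is [nleft]. Then [lc t] fails, so the filler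
   contributes to its own drift and there is room. *)
rewrite cl; have [lct|nlc] := boolP (lc t); first by have := lc_lt lct; lia.
by have := drift_gt0 lt nlc; move: lt; rewrite /left; lia.
Qed.

Lemma filler_keys i c : exists phi, forall t, filler_ok i c phi t.
Proof.
suff h j : (j <= K)%N -> exists phi, forall t : 'I_K, (K - j <= t)%N -> filler_ok i c phi t.
  by have [phi ok] := h K (leqnn K); exists phi => t; apply: ok; rewrite subnn.
elim: j => [_|j IH lt_jK].
  by exists (fun=> 0) => t; rewrite subn0 leqNgt ltn_ord.
have [phi ok] := IH (ltnW lt_jK).
have lt0 : (K - j.+1 < K)%N by lia.
pose t0 := Ordinal lt0.
pose A : pred item := [pred a | [&& phase_active i c t0 a, a != Mov (Filler i t0) c &
                    on_left a == left t0]].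
have movP a : A a -> is_filler a ->
    exists2 k : 'I_K, a = Mov (Filler i k) c & (t0 < k)%N.
  case: a => [[j' d|j' k|s] c'|[j' d|j' k|s] c'|k] //=.
  case/and3P=> /and3P[/eqP -> le_k /eqP ->] ne _ _; exists k => //.
  rewrite ltn_neqAle le_k andbT; apply: contraNneq ne => kE.
  by apply/eqP; congr (Mov (Filler _ _) _); apply: val_inj.
have skeyE a : ~~ is_filler a -> partial_key phi a = static_key a.
  by case: a => [[j' d|j' k|s] c'|[j' d|j' k|s] c'|k].
have regA a : A a -> ~~ in_region a.
  by case: a => [[j' d|j' k|s] c'|[j' d|j' k|s] c'|k].
have ge_t0 (k : 'I_K) : (t0 < k)%N -> filler_ok i c phi k.
  by move=> lt_k; apply: ok; move: lt_k => /=; lia.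
have inA a : A a -> (bounds (left t0)).1 < partial_key phi a < (bounds (left t0)).2.
  move=> Aa; have [fa|nfa] := boolP (is_filler a).
    have [k aE lt_k] := movP a Aa fa.
    move: Aa; rewrite aE /A /= => /and3P[_ _ /eqP <-].
    exact: fok_bounds (ge_t0 _ lt_k).
  have := rk_bounds a; rewrite skeyE // /bounds.
  have /and3P[_ _ /eqP <-] := Aa.
  have [la|ra] := boolP (on_left a); first by rewrite static_left //= => *; apply/andP; lra.
  by rewrite static_right ?regA //= => *; apply/andP; lra.
have injA : {in A &, injective (partial_key phi)}.
  move=> a a' Aa Aa'.
  have [fa|nfa] := boolP (is_filler a); have [fa'|nfa'] := boolP (is_filler a').
  - have [k aE lt_k] := movP a Aa fa; have [k' aE' lt_k'] := movP a' Aa' fa'.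
    rewrite aE aE' /= => eq_phi; congr (Mov (Filler _ _) _); apply: val_inj => /=.
    have [lt|lt|//] := ltngtP k k'.
      by have := fok_later (ge_t0 _ lt_k) lt; rewrite eq_phi eqxx.
    by have := fok_later (ge_t0 _ lt_k') lt; rewrite eq_phi eqxx.
  - have [k aE lt_k] := movP a Aa fa; rewrite [X in _ = X]skeyE // aE /= => eq_phi.
    by have := fok_static (ge_t0 _ lt_k) a'; rewrite eq_phi eqxx.
  - have [k aE lt_k] := movP a' Aa' fa'; rewrite skeyE // aE /= => eq_phi.
    by have := fok_static (ge_t0 _ lt_k) a; rewrite eq_phi eqxx.
  rewrite !skeyE //; have /and3P[_ _ /eqP la] := Aa; have /and3P[_ _ /eqP la'] := Aa'.
  have [lt|rt] := boolP (left t0).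
    rewrite !static_left ?la ?la' //; move/addrI/oppr_inj; exact: rk_inj.
  rewrite !static_right ?la ?la' ?regA //; move/addrI; exact: rk_inj.
have lohi : (bounds (left t0)).1 < (bounds (left t0)).2.
  have : 0 <= #|{: item}|%:R :> rat by exact: ler0n.
  by rewrite /bounds; case: (left t0) => /=; lra.
(* The two lists of avoided keys yield [fok_static] and [fok_later]. *)
have [y [loy yhi yZ yc]] := insert_key lohi injA inA
  (map static_key (enum {: item}) ++ [seq phi (nat_of_ord k) | k : 'I_K]) (target_le i c t0).
move: yZ; rewrite mem_cat negb_or => /andP[yZ1 yZ2].
pose phi' k := if k == t0 :> nat then y else phi k.
have phi0 : phi' t0 = y by rewrite /phi' eqxx.
have phi_gt (k : 'I_K) : (t0 < k)%N -> phi' k = phi k by move=> lt; rewrite /phi' gtn_eqF.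
exists phi' => t le_t; have [tE|ne_t] := eqVneq t t0.
  rewrite tE; split; rewrite ?phi0.
  - by rewrite loy yhi.
  - by move=> a; apply: contraNneq yZ1 => <-; rewrite map_f // mem_enum.
  - move=> k lt_k; rewrite phi_gt //; apply: contraNneq yZ2 => <-.
    by rewrite map_f // mem_enum.
  rewrite -yc; apply: eq_card => a; rewrite !inE -!andbA.
  case pa: (phase_active i c t0 a) => //=; case ne: (a != _) => //=.
  case la: (_ == _) => //=.
  have Aa : A a by rewrite /A /= pa ne la.
  have [fa|nfa] := boolP (is_filler a).
    by have [k -> lt_k] := movP a Aa fa; rewrite /= phi_gt.
  by congr (_ < _); rewrite skeyE //; case: (a) nfa => [[]|[]|].
have lt_t : (t0 < t)%N.
  by rewrite ltn_neqAle eq_sym ne_t; move: le_t => /=.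
have [ok1 ok2 ok3 ok4] := ge_t0 _ lt_t; split; rewrite ?phi_gt //.
  by move=> k lt_k; rewrite phi_gt ?ok3 // (ltn_trans lt_t).
rewrite -ok4; apply: eq_card => a; rewrite !inE.
case pa: (phase_active i c t a) => //=; congr [&& _, _ & _ < _].
case: (a) pa => [[j' d|j' k|s] c'|[j' d|j' k|s] c'|k] //= /and3P[_ le_k _].
by rewrite phi_gt // (leq_trans lt_t).
Qed.


Definition full_key (phi : 'I_n.+1 -> bool -> nat -> rat) (psi : nat -> rat) (a : item) : rat :=
  match a with
  | Mov (Filler i k) c => phi i c k
  | Mov (Tran s) _ => psi s
  | _ => static_key a
  end.

(** The rank [q] counts from 1, as index-selector functions do. *)
Record rank_ok (key : item -> rat) b (a : item) (q : nat) : Prop := RankOk {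
  rank_active : active b a;
  rank_neq : forall a', active b a' -> a' != a -> key a' != key a;
  rank_card : #|[pred a' | active b a' & key a' < key a]|.+1 = q }.

Section Ranks.
Variable phi : 'I_n.+1 -> bool -> nat -> rat.
Hypothesis phi_ok : forall i c t, filler_ok i c (phi i c) t.

(** The window always has [n * 4] active items. Whichever they are, all of them precede a filler on
    the right and none precedes one on the left, so the rank does not depend on the state of the
    counter. *)
Lemma filler_rank psi i (t : 'I_K) b : phase i t T b ->
  rank_ok (full_key phi psi) b (Mov (Filler i t) (better b i)) (x t).
Proof.
move=> ph; set c := better b i; set e : item := Mov _ _.
have [ok1 ok2 ok3 ok4] := phi_ok i c t.
have item0 : 1 <= #|{: item}|%:R :> rat by rewrite ler1n; apply/card_gt0P; exists e.
have n2 : 0 <= (n * 2)%:R :> rat by exact: ler0n.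
have movP j k d : phase_active i c t (Mov (Filler j k) d) -> Mov (Filler j k) d != e ->
    [/\ j = i, d = c & (t < k)%N].
  case/and3P=> /eqP -> le_k /eqP -> ne; split=> //.
  rewrite ltn_neqAle le_k andbT; apply: contraNneq ne => kE.
  by apply/eqP; congr (Mov (Filler _ _) _); apply: val_inj.
have lkey a : phase_active i c t a -> on_left a -> full_key phi psi a < 0.
  case: a => [[j d|j k|s] c'|[j d|j k|s] c'|k] //=.
  - case/and3P=> /eqP -> _ /eqP ->; move=> lk.
    by have [] := phi_ok i c k; rewrite lk /= => /andP[].
  - by move=> _ ->; have := rk_bounds (Chk (Filler j k) c'); lra.
  - by move=> _ ->; have := rk_bounds (Gain k); lra.
have rkey a : phase_active i c t a -> ~~ on_left a -> bnd - 1 < full_key phi psi a.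
  case: a => [[j d|j k|s] c'|[j d|j k|s] c'|k] //=.
  - case/and3P=> /eqP -> _ /eqP ->; move=> lk.
    by have [] := phi_ok i c k; rewrite (negbTE lk) /= => /andP[].
  - by move=> _ /negbTE ->; have := rk_bounds (Chk (Filler j k) c'); lra.
  - by move=> _ _; have := rk_bounds (Chk (Tran s) c'); lra.
  - by move=> _ /negbTE ->; have := rk_bounds (Gain k); lra.
have reg a : in_region a -> full_key phi psi a = static_key a.
  by case: a => [[j d|j k|s] c'|[j d|j k|s] c'|k].
have pkey a : phase_active i c t a -> a != e ->
    full_key phi psi a = partial_key (phi i c) a.
  case: a => [[j d|j k|s] c'|[j d|j k|s] c'|k] // pa ne.
  by have [-> -> _] := movP _ _ _ pa ne.
split.
- by rewrite (phase_activeE ph) //= !eqxx leqnn.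
- move=> a aa ne; have [ra|nra] := boolP (in_region a); first by rewrite reg.
  rewrite (phase_activeE ph) // in aa; rewrite pkey //.
  have [fa|nfa] := boolP (is_filler a); last first.
    by have -> : partial_key (phi i c) a = static_key a by case: (a) nfa => [[]|[]|].
  case: a fa {nra} aa ne => [[j d|j k|s] c'|[j d|j k|s] c'|k] // _ pa ne.
  by have [_ _ /ok3] := movP _ _ _ pa ne.
have [lt|rt] := boolP (left t).
  rewrite (@eq_card _ _ [pred a | [&& phase_active i c t a, a != Mov (Filler i t) c,
                  on_left a == left t & partial_key (phi i c) a < phi i c t]]).
    by rewrite ok4 /target lt prednK.
  move=> a; rewrite !inE -/e; have [ra|nra] := boolP (in_region a).
    have [s0 _] := static_region ra; rewrite reg //.
    have -> : phase_active i c t a = false by case: (a) ra => [[]|[]|].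
    apply/negbTE; rewrite negb_and -leNgt; apply/orP; right.
    by move: ok1; rewrite lt /= => /andP[_ h]; apply: ltW (lt_le_trans h s0).
  rewrite (phase_activeE ph) //; case pa: (phase_active _ _ _ _) => //=.
  have [->|ne] /= := eqVneq a e; first by rewrite ltxx.
  rewrite pkey // lt; case la: (on_left a) => //=; apply/negbTE; rewrite -leNgt.
  rewrite -pkey //; apply: ltW; apply: lt_trans (rkey _ pa (negbT la)).
  by move: ok1; rewrite lt /= natrD => /andP[_ h]; lra.
have /andP[ok11 _] := ok1; rewrite (negbTE rt) /= in ok11.
have -> : #|[pred a' | active b a' & full_key phi psi a' < full_key phi psi e]| =
   (n * 4 + (nleft + drift t) + target t)%N.
  rewrite -ok4 -(active_region b) -(card_phase_left i c t) !card_sum_nat -!big_split /=.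
  apply: eq_bigr => a _; have [ra|nra] := boolP (in_region a).
    have -> : phase_active i c t a = false by case: (a) ra => [[]|[]|].
    rewrite reg // andbT; have [_ s1] := static_region ra.
    by rewrite (le_lt_trans s1 ok11) andbT !addn0.
  rewrite (phase_activeE ph) // -/c !andbF; case pa: (phase_active _ _ _ _) => //=.
  have [->|ne] := eqVneq a e; first by rewrite /= ltxx (negbTE rt).
  rewrite pkey // (negbTE rt); case la: (on_left a) => /=; last by [].
  rewrite -pkey // (lt_trans (lkey _ pa la)) //; apply: le_lt_trans ok11.
  by rewrite natrD; lra.
(* By [gap] and [drift t <= drift 0], the truncated subtraction in [target] is exact. *)
rewrite /target (negbTE rt); have := gap (ltn_ord t); rewrite -[(x t <= r)%N]/(left t) (negbTE rt) /=.
by have := drift_le t; have := x_pos t; move: nleft_r; clear; lia.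
Qed.

Lemma drift_end : drift K = 0%N.
Proof. by apply: big1 => k _; rewrite leqNgt ltn_ord !andbF. Qed.

(** With all fillers consumed the drift is 0, so [nleft = r - 1] active items precede the window.
    Inside it, counter switches come first, ordered by decreasing level and with [v] before [u];
    hence the preferred one is the first active item. *)
Lemma real_rank psi i b j c : phase i K T b -> next_real b j c ->
  rank_ok (full_key phi psi) b (Mov (Real j c) (better b j)) r.
Proof.
move=> ph nr; set e : item := Mov _ _.
have [st sf above _] := nr.
have stj : stale b (Real j c) by case: (c) st sf.
pose o (k : 'I_n) (d : bool) := ((n - k.+1) * 2 + ~~ d)%N.
have o_lt k d : (o k d < n * 2)%N by rewrite /o; have := ltn_ord k; case: d => /=; lia.
have o_inj k d k' d' : o k d = o k' d' -> k = k' /\ d = d'.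
  rewrite /o => oE; have kE : k = k'.
    by apply: val_inj => /=; move: oE; have := ltn_ord k; have := ltn_ord k'; case: d; case: d' => /=; lia.
  by split=> //; move: oE; rewrite kE; case: d; case: d' => //=; lia.
have o_pos k d : 0 <= (o k d)%:R :> rat by exact: ler0n.
have o_ltr k d : (o k d)%:R < (n * 2)%:R :> rat by rewrite ltr_nat.
have lkey a : phase_active i (better b i) K a -> on_left a -> full_key phi psi a < 0.
  case: a => [[j' d|j' k|s] c'|[j' d|j' k|s] c'|k] //=.
  - by case/and3P=> _; rewrite leqNgt ltn_ord.
  - by move=> _ ->; have := rk_bounds (Chk (Filler j' k) c'); lra.
  - by move=> _ ->; have := rk_bounds (Gain k); lra.
have rkey a : phase_active i (better b i) K a -> ~~ on_left a -> bnd <= full_key phi psi a.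
  case: a => [[j' d|j' k|s] c'|[j' d|j' k|s] c'|k] //=.
  - by case/and3P=> _; rewrite leqNgt ltn_ord.
  - by move=> _ /negbTE ->; have := rk_bounds (Chk (Filler j' k) c'); lra.
  - by move=> _ _; have := rk_bounds (Chk (Tran s) c'); lra.
  - by move=> _ /negbTE ->; have := rk_bounds (Gain k); lra.
have item0 : 0 <= #|{: item}|%:R :> rat by exact: ler0n.
have eE : full_key phi psi e = (o j c)%:R by [].
split.
- by rewrite /= stj eqxx.
- move=> a aa ne; rewrite eE; have [ra|nra] := boolP (in_region a).
    case: a ra aa ne => [[k d|//|//] d'|[k d|//|//] d'|//] _ aa ne /=.
      apply: contraNneq ne => /eqP; rewrite eqr_nat => /eqP/o_inj[kE dE].
      move: aa => /= /andP[_ /eqP ->]; apply/eqP; rewrite /e kE dE //.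
    have := rk_bounds (Chk (Real k d) d'); have := o_ltr j c => h1 [h2 _].
    by rewrite gt_eqF //; lra.
  rewrite (phase_activeE ph) // in aa; have [la|rra] := boolP (on_left a).
    by rewrite lt_eqF // (lt_le_trans (lkey _ aa la)).
  have := rkey _ aa rra; have := o_ltr j c; rewrite natrD => h1 h2.
  by rewrite gt_eqF //; lra.
rewrite -nleft_r -[nleft]addn0 -drift_end -(card_phase_left i (better b i)); congr _.+1.
apply: eq_card => a; rewrite !inE eE; have [ra|nra] := boolP (in_region a).
  have -> : phase_active i (better b i) K a = false by case: (a) ra => [[]|[]|].
  apply/negbTE/negP => /andP[]; case: a ra => [[k d|//|//] d'|[k d|//|//] d'|//] _ aa /=.
    rewrite ltr_nat /o => lt_o; move: aa => /= /andP[sk _].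
    have [lt_kj|lt_jk|kj] := ltngtP k j.
    - by move: lt_o; have := ltn_ord j; case: (d); case: (c) => /=; lia.
    - by have := above k d lt_jk; rewrite sk.
    - have kE : k = j by exact: val_inj.
      move: lt_o sk; rewrite kE; case: (d) => /= [|lt_o]; last by move: lt_o; case: (c) => /=; lia.
      by rewrite st; case: (c) => //=; lia.
  by have := rk_bounds (Chk (Real k d) d'); have := o_ltr j c; lra.
rewrite (phase_activeE ph) //; case pa: (phase_active _ _ _ _) => //=.
case la: (on_left a); first by rewrite (lt_le_trans (lkey _ pa la)).
apply/negbTE; rewrite -leNgt; have := rkey _ pa (negbT la); have := o_ltr j c.
by rewrite natrD; lra.
Qed.

(** Before the first counter switch the activity of every item is known, that of the window
    included. *)
Definition start_stale s (y : follower) : bool :=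
  match y with
  | Real j _ => j == 0 :> nat | Filler j _ => j == ord0 | Tran k => (s <= k)%N
  end.

Definition start_active s (a : item) : bool :=
  match a with
  | Mov y d => start_stale s y && ~~ d
  | Chk y d => ~~ (start_stale s y && ~~ d)
  | Gain _ => true
  end.

Lemma start_activeE s b a : phase ord0 0 s b -> active b a = start_active s a.
Proof.
case=> pf pt pv pu.
have bE l : better b l = false.
  case: l => // l; have [lt_ln|le_nl] := ltnP l n; last by rewrite better_out.
  by rewrite -[l.+1]/((Ordinal lt_ln).+1) better_stale pv pu //=; case: (l == 0).
have sE y : stale b y = start_stale s y.
  by case: y => [j [|]|j k|k]; rewrite ?pv ?pu ?pf ?pt ?andbT.
by case: a => [y d|y d|k] //=; rewrite sE bE eqbF_neg.
Qed.

Lemma card_start_active s : #|start_active s| = (n * 4 + n.+1 * K * 2 + T * 2 + C)%N.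
Proof.
rewrite card_sum_nat sum_item /= sum_nat_const card_ord muln1; congr (_ + _)%N.
rewrite (eq_bigr (fun=> 2)%N) => [|y _].
  by rewrite sum_nat_const card_follower; lia.
rewrite (eq_bigr (fun=> 1)%N) => [|d _]; first by rewrite sum_nat_const card_bool.
by case: (_ && _).
Qed.

Definition is_tran (a : item) : bool := if a is Mov (Tran _) _ then true else false.

Local Notation key0 := (full_key phi (fun=> 0)).

Lemma key0_inj s : {in [pred a | start_active s a & ~~ is_tran a] &, injective key0}.
Proof.
have item0 : 0 <= #|{: item}|%:R :> rat by exact: ler0n.
have bndE : bnd = (n * 2)%:R + #|{: item}|%:R by rewrite natrD.
have n2 : 0 <= (n * 2)%:R :> rat by exact: ler0n.
have o_lt (k : 'I_n) d : 0 <= ((n - k.+1) * 2 + ~~ d)%:R :> rat /\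
    ((n - k.+1) * 2 + ~~ d)%:R < (n * 2)%:R :> rat.
  by rewrite ler0n ltr_nat; have := ltn_ord k; case: d => /=; split=> //; lia.
have key_static a : ~~ is_filler a -> ~~ is_tran a -> key0 a = static_key a.
  by case: a => [[]|[]|].
move=> a a'; rewrite !inE => /andP[aa ta] /andP[aa' ta'].
have [fa|nfa] := boolP (is_filler a); have [fa'|nfa'] := boolP (is_filler a').
- case: a fa aa ta => [[//|j k|//] d|//|//] _ /= /andP[/eqP -> /negbTE ->] _.
  case: a' fa' aa' ta' => [[//|j' k'|//] d'|//|//] _ /= /andP[/eqP -> /negbTE ->] _ eq_phi.
  congr (Mov (Filler _ _) _); apply: val_inj => /=.
  have [lt|lt|//] := ltngtP k k'.
    by have := fok_later (phi_ok ord0 false k) lt; rewrite eq_phi eqxx.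
  by have := fok_later (phi_ok ord0 false k') lt; rewrite eq_phi eqxx.
- rewrite [X in _ = X]key_static //.
  case: a fa aa ta => [[//|j k|//] d|//|//] _ /= /andP[/eqP -> /negbTE ->] _ eq_phi.
  by have := fok_static (phi_ok ord0 false k) a'; rewrite eq_phi eqxx.
- rewrite key_static //.
  case: a' fa' aa' ta' => [[//|j k|//] d|//|//] _ /= /andP[/eqP -> /negbTE ->] _ eq_phi.
  by have := fok_static (phi_ok ord0 false k) a; rewrite eq_phi eqxx.
rewrite !key_static // => eq_key.
have rka := rk_bounds a; have rka' := rk_bounds a'.
have [la|rra] := boolP (on_left a).
  move: eq_key; rewrite static_left //; have [la'|rra'] := boolP (on_left a').
    by rewrite static_left // => /addrI/oppr_inj/rk_inj.
  have [ra'|nra'] := boolP (in_region a'); first by have := static_region ra'; move=> *; exfalso; lra.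
  by rewrite static_right //; move=> *; exfalso; lra.
have [la'|rra'] := boolP (on_left a').
  move: eq_key; rewrite (static_left la').
  have [ra|nra] := boolP (in_region a); first by have := static_region ra; move=> *; exfalso; lra.
  by rewrite static_right //; move=> *; exfalso; lra.
have [ra|nra] := boolP (in_region a); have [ra'|nra'] := boolP (in_region a').
- case: a ra aa eq_key rka {ta nfa rra} => [[j c|//|//] d|[j c|//|//] d|//] _ aa eq_key rka;
  case: a' ra' aa' eq_key rka' {ta' nfa' rra'} => [[j' c'|//|//] d'|[j' c'|//|//] d'|//] _ aa' /= eq_key rka'.
  + move/eqP: eq_key; rewrite eqr_nat => /eqP oE.
    have jE : j = j'.
      apply: val_inj => /=; move: oE; have := ltn_ord j; have := ltn_ord j'.
      by case: (c); case: (c') => /=; lia.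
    move: aa aa' => /= /andP[_ /negbTE ->] /andP[_ /negbTE ->].
    by move: oE; rewrite jE; case: (c); case: (c') => //=; lia.
  + by have := o_lt j c; move=> *; exfalso; lra.
  + by have := o_lt j' c'; move=> *; exfalso; lra.
  + by move/addrI: eq_key => /rk_inj.
- by move: eq_key; rewrite [X in _ = X]static_right //; have := static_region ra; move=> *; exfalso; lra.
- by move: eq_key; rewrite static_right //; have := static_region ra'; move=> *; exfalso; lra.
by move: eq_key; rewrite !static_right // => /addrI/rk_inj.
Qed.

Variable y : nat -> nat.
Hypothesis y_le : forall s, (y s <= n * 4 + n.+1 * K * 2 + T * 2 + C)%N.
Hypothesis y_pos : forall s, (0 < y s)%N.

Local Notation span := (1 + \sum_a `|key0 a|).

Lemma key0_span a : - span < key0 a < span.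
Proof.
have : `|key0 a| <= \sum_a `|key0 a|.
  by rewrite (bigD1 a) //= lerDl sumr_ge0.
by move=> h; rewrite -ltr_norml; lra.
Qed.

Record tran_ok (psi : nat -> rat) (s : 'I_T) : Prop := TranOk {
  tok_bounds : - span < psi s < span;
  tok_key0 : forall a, key0 a != psi s;
  tok_later : forall k : 'I_T, (s < k)%N -> psi k != psi s;
  tok_rank : #|[pred a | [&& start_active s a, a != Mov (Tran s) false &
                  full_key phi psi a < psi s]]| = (y s).-1 }.

(** Backward insertion as for [filler_keys], but without sides: a transient follower may be placed
    anywhere, even inside the window. *)
Lemma tran_keys : exists psi, forall s, tran_ok psi s.
Proof.
suff h j : (j <= T)%N -> exists psi, forall s : 'I_T, (T - j <= s)%N -> tran_ok psi s.
  by have [psi ok] := h T (leqnn T); exists psi => s; apply: ok; rewrite subnn.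
elim: j => [_|j IH lt_jT].
  by exists (fun=> 0) => s; rewrite subn0 leqNgt ltn_ord.
have [psi ok] := IH (ltnW lt_jT).
have lt0 : (T - j.+1 < T)%N by lia.
pose s0 := Ordinal lt0.
pose A : pred item := [pred a | start_active s0 a & a != Mov (Tran s0) false].
have movP a : A a -> is_tran a ->
    exists2 k : 'I_T, a = Mov (Tran k) false & (s0 < k)%N.
  case: a => [[//|//|k] d|//|//] /=.
  case/andP=> /andP[le_k /negbTE dE] ne _; rewrite dE in ne *; exists k => //.
  rewrite ltn_neqAle (le_k : (s0 <= k)%N) andbT; apply: contraNneq ne => kE.
  by apply/eqP; congr (Mov (Tran _) _); apply: val_inj.
have skeyE psi' a : ~~ is_tran a -> full_key phi psi' a = key0 a.
  by case: a => [[]|[]|].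
have ge_s0 (k : 'I_T) : (s0 < k)%N -> tran_ok psi k.
  by move=> lt_k; apply: ok; move: lt_k => /=; lia.
have inA a : A a -> - span < full_key phi psi a < span.
  move=> Aa; have [fa|nfa] := boolP (is_tran a); last by rewrite skeyE // key0_span.
  have [k -> lt_k] := movP a Aa fa; exact: tok_bounds (ge_s0 _ lt_k).
have injA : {in A &, injective (full_key phi psi)}.
  move=> a a' Aa Aa'.
  have [fa|nfa] := boolP (is_tran a); have [fa'|nfa'] := boolP (is_tran a').
  - have [k aE lt_k] := movP a Aa fa; have [k' aE' lt_k'] := movP a' Aa' fa'.
    rewrite aE aE' /= => eq_psi; congr (Mov (Tran _) _); apply: val_inj => /=.
    have [lt|lt|//] := ltngtP k k'.
      by have := tok_later (ge_s0 _ lt_k) lt; rewrite eq_psi eqxx.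
    by have := tok_later (ge_s0 _ lt_k') lt; rewrite eq_psi eqxx.
  - have [k aE lt_k] := movP a Aa fa; rewrite [X in _ = X]skeyE // aE /= => eq_psi.
    by have := tok_key0 (ge_s0 _ lt_k) a'; rewrite eq_psi eqxx.
  - have [k aE lt_k] := movP a' Aa' fa'; rewrite skeyE // aE /= => eq_psi.
    by have := tok_key0 (ge_s0 _ lt_k) a; rewrite eq_psi eqxx.
  have /andP[sa _] := Aa; have /andP[sa' _] := Aa'.
  by rewrite !skeyE //; apply: (@key0_inj s0); rewrite inE ?sa ?sa'.
have span0 : 0 <= \sum_a `|key0 a| by exact: sumr_ge0.
have lohi : - span < span by lra.
have cA : ((y s0).-1 <= #|A|)%N.
  have cE : #|start_active s0| = #|A|.+1.
    rewrite (cardD1 (Mov (Tran s0) false)) {1}unfold_in /= leqnn /= add1n.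
    by congr _.+1; apply: eq_card => a; rewrite !inE andbC.
  move: (y_le s0) (y_pos s0); rewrite -(card_start_active s0) cE.
  by case: (y s0).
have [z [loz zhi zZ zc]] := insert_key lohi injA inA
  (map key0 (enum {: item}) ++ [seq psi (nat_of_ord k) | k : 'I_T]) cA.
move: zZ; rewrite mem_cat negb_or => /andP[zZ1 zZ2].
pose psi' k := if k == s0 :> nat then z else psi k.
have psi0 : psi' s0 = z by rewrite /psi' eqxx.
have psi_gt (k : 'I_T) : (s0 < k)%N -> psi' k = psi k by move=> lt; rewrite /psi' gtn_eqF.
exists psi' => s le_s; have [sE|ne_s] := eqVneq s s0.
  rewrite sE; split; rewrite ?psi0.
  - by rewrite loz zhi.
  - by move=> a; apply: contraNneq zZ1 => <-; rewrite map_f // mem_enum.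
  - move=> k lt_k; rewrite psi_gt //; apply: contraNneq zZ2 => <-.
    by rewrite map_f // mem_enum.
  rewrite -zc; apply: eq_card => a; rewrite !inE -!andbA.
  case pa: (start_active s0 a) => //=; case ne: (a != _) => //=.
  have Aa : A a by rewrite /A /= pa ne.
  have [fa|nfa] := boolP (is_tran a); last by rewrite !skeyE.
  by have [k -> lt_k] := movP a Aa fa; rewrite /= psi_gt.
have lt_s : (s0 < s)%N.
  by rewrite ltn_neqAle eq_sym ne_s; move: le_s => /=.
have [ok1 ok2 ok3 ok4] := ge_s0 _ lt_s; split; rewrite ?psi_gt //.
  by move=> k lt_k; rewrite psi_gt ?ok3 // (ltn_trans lt_s).
rewrite -ok4; apply: eq_card => a; rewrite !inE.
case pa: (start_active s a) => //=; congr (_ && (_ < _)).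
case: (a) pa => [[j' d|j' k|k] c'|[j' d|j' k|k] c'|k] //= /andP[le_k _].
by rewrite psi_gt // (leq_trans lt_s).
Qed.

Lemma tran_rank psi (s : 'I_T) b : (forall s, tran_ok psi s) -> phase ord0 0 s b ->
  rank_ok (full_key phi psi) b (Mov (Tran s) false) (y s).
Proof.
move=> psi_ok ph; have [ok1 ok2 ok3 ok4] := psi_ok s; split.
- by rewrite (start_activeE _ ph) /= leqnn.
- move=> a; rewrite (start_activeE _ ph) => aa ne.
  have [ta|nta] := boolP (is_tran a); last first.
    by have -> : full_key phi psi a = key0 a by case: (a) nta => [[]|[]|].
  case: a ta aa ne => [[//|//|k] d|//|//] _ /= /andP[le_k /negbTE ->] ne.
  apply: ok3; rewrite ltn_neqAle le_k andbT; apply: contraNneq ne => kE.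
  by apply/eqP; congr (Mov (Tran _) _); apply: val_inj.
rewrite -[RHS](prednK (y_pos s)) -ok4; congr _.+1; apply: eq_card => a.
rewrite !inE (start_activeE _ ph); case: (start_active s a) => //=.
by have [->|] //= := eqVneq a (Mov (Tran s) false); rewrite ltxx.
Qed.

End Ranks.

Lemma arrangement (y : nat -> nat) :
  (forall s, (0 < y s <= n * 4 + n.+1 * K * 2 + T * 2 + C)%N) ->
  exists key : item -> rat,
  [/\ forall i (t : 'I_K) b, phase i t T b ->
        rank_ok key b (Mov (Filler i t) (better b i)) (x t),
      forall i b j c, phase i K T b -> next_real b j c ->
        rank_ok key b (Mov (Real j c) (better b j)) r &
      forall (s : 'I_T) b, phase ord0 0 s b ->
        rank_ok key b (Mov (Tran s) false) (y s)].
Proof.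
move=> y_bounds.
have [phi phi_ok] : exists phi : 'I_n.+1 -> bool -> nat -> rat,
    forall i c t, filler_ok i c (phi i c) t.
  have h (ic : 'I_n.+1 * bool) : exists phi, forall t, filler_ok ic.1 ic.2 phi t.
    exact: filler_keys.
  have [phi ok] := fin_all_exists h.
  by exists (fun i c => phi (i, c)) => i c t; apply: (ok (i, c)).
have [psi psi_ok] := tran_keys phi_ok (fun s => proj2 (andP (y_bounds s)))
  (fun s => proj1 (andP (y_bounds s))).
exists (full_key phi psi); split.
- exact: filler_rank.
- exact: real_rank.
by move=> s b; apply: tran_rank => // s'; case/andP: (y_bounds s').
Qed.

End Arrange.

(** * Runs *)

(** Negating the keys reverses the order of the active items, whose number is constant. *)
Lemma rank_ok_opp n K T C (key : item n K T C -> rat) b a q :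
  rank_ok key b a q ->
  rank_ok (fun a' => - key a') b a ((#|{: follower n K T}| * 2 + C).+1 - q).
Proof.
case=> aa neq <-; split=> //.
  by move=> a' aa' ne; rewrite eqr_opp neq.
rewrite subSS -(card_active C b).
have -> : #|@active n K T C b| = (#|[pred a' | active b a' & (key a' < key a)%R]| +
    #|[pred a' | active b a' & (key a <= key a')%R]|)%N.
  apply: etrans (esym (cardID [pred a' | key a' < key a] _)) _.
  congr (_ + _)%N; apply: eq_card => a'; rewrite !inE ?leNgt andbC //.
rewrite addKn [RHS](cardD1 a) !inE lexx aa add1n; congr _.+1.
apply: eq_card => a'; rewrite !inE.
have [->|ne] /= := eqVneq a' a; first by rewrite ltxx andbF.
case aa': (active b a') => //=; rewrite ltrN2 lt_neqAle eq_sym.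
by rewrite neq.
Qed.

Section Run.
Variables (n K T C Q : nat) (key : item n K T C -> rat).
Local Notation G := (game Q key).
Local Notation p := (#|{: follower n K T}| * 2 + C)%N.
Variables (P : nat -> nat -> nat -> nat * nat) (idx g : nat -> nat) (hs : nat).
Hypothesis PE : forall h, P p (num_edges0 G) h = (idx h, g h).
Hypothesis n_gt0 : (0 < n)%N.
Hypothesis key_filler : forall i (t : 'I_K) b, phase i t T b ->
  rank_ok key b (Mov (Filler i t) (better b i)) (idx (iter t g hs)).
Hypothesis key_real : forall i b j c, phase i K T b -> next_real b j c ->
  rank_ok key b (Mov (Real j c) (better b j)) (idx (iter K g hs)).
Hypothesis key_tran : forall (s : 'I_T) b, phase ord0 0 s b ->
  rank_ok key b (Mov (Tran s) false) (idx (iter s g 1%N)).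
Hypothesis cycle_hs : iter K.+1 g hs = hs.
Hypothesis reach_hs : iter T g 1%N = hs.

Lemma rank_step b x c h : rank_ok key b (Mov x c) (idx h) ->
  si_step (G := G) P (strat C Q b, h) = (strat C Q (flip b x), g h).
Proof.
case=> aa neq cE; rewrite (si_step_mov (P := P) (h := h) aa neq) ?PE //=.
rewrite -cE -size_filter cardE; congr (size _).+1.
by rewrite /enum_mem -filter_predI; apply: eq_filter => a; rewrite /= !inE andbC.
Qed.

(** Either the memory is on its way from 1 to [hs], using one transient follower per step, or it is
    [t] steps into a round of [K] fillers and one counter switch. *)
Definition tracked (b : follower n K T -> bool) h : Prop :=
  (exists2 s, (s < T)%N & phase ord0 0 s b /\ h = iter s g 1%N) \/
  (exists i t, [/\ (t <= K)%N, phase i t T b & h = iter t g hs]).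

Lemma potential_flip_filler b (x : follower n K T) : ~~ is_real x ->
  potential (flip b x) = potential b.
Proof.
move=> nx; apply: eq_bigr => i _; rewrite !stale_flip_filler //.
by have ne c : (Real i c == x) = false by [apply/eqP => xE; rewrite -xE in nx]; rewrite !ne !addbF.
Qed.

Lemma tracked_step b h : tracked b h -> (0 < potential b)%N ->
  exists b', [/\ si_step (G := G) P (strat C Q b, h) = (strat C Q b', g h),
    tracked b' (g h) & (potential b <= (potential b').+1)%N].
Proof.
case=> [[s lt_sT [ph ->]]|[i [t [le_tK ph ->]]]] pot.
  pose s' := Ordinal lt_sT.
  exists (flip b (Tran s')); split.
  - exact/rank_step/(key_tran (s := s')).
  - have ph' := phase_flip_tran (s := s') ph.
    have [lt'|ge'] := ltnP s.+1 T; first by left; exists s.+1.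
    right; exists ord0, 0; have sT : s.+1 = T by apply/eqP; rewrite eqn_leq lt_sT.
    by rewrite /= sT in ph'; split=> //=; rewrite -reach_hs -sT.
  - by rewrite potential_flip_filler.
move: le_tK; rewrite leq_eqVlt => /orP[/eqP tK|lt_tK].
  rewrite tK in ph *; have [j [c nr]] := next_real_ex ph pot.
  exists (flip b (Real j c)); split.
  - exact/rank_step/(key_real ph nr).
  - right; exists (lift ord0 j), 0; split=> //; exact: phase_flip_real ph nr.
  - by rewrite (potential_flip_real nr).
pose t' := Ordinal lt_tK.
exists (flip b (Filler i t')); split.
- exact/rank_step/(key_filler (t := t')).
- by right; exists i, t.+1; split=> //; apply: (phase_flip_filler (t := t')).
- by rewrite potential_flip_filler.
Qed.

Lemma run_tracked k : (k <= 2 * (2 ^ n).-1)%N ->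
  exists b h, [/\ si_run (G := G) P (strat C Q (@start n K T)) k = (strat C Q b, h),
    tracked b h & (2 * (2 ^ n).-1 <= potential b + k)%N].
Proof.
elim: k => [_|k IH lt_k].
  exists (@start n K T), 1%N; split=> //; last by rewrite potential_start // addn0.
  have ph := phase_start n K T; have [T0|T_gt0] := posnP T; last by left; exists 0%N.
  by right; exists ord0, 0%N; split=> //=; [rewrite {2}T0 | rewrite -reach_hs T0].
have [b [h [runk tr pot]]] := IH (ltnW lt_k).
have [|b' [step tr' pot']] := tracked_step tr; first by lia.
exists b', (g h); split=> //; last by lia.
by rewrite /si_run iterS -/(si_run _ _ _) runk.
Qed.

(** The potential keeps the run in tracked strategies [strat b] up to step [k], and each of these
    has the same positive number of improving switches. *)
Lemma run_unfinished k : (k <= 2 * (2 ^ n).-1)%N ->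
  sorted_switches (G := G) (si_run (G := G) P (strat C Q (@start n K T)) k).1 != [::].
Proof.
case/run_tracked => b [h [-> _ _]]; rewrite -size_eq0 size_switches card_active /=.
by rewrite card_follower; lia.
Qed.

End Run.

(** * Choice of the parameters *)

Section Gap.
Local Open Scope nat_scope.
Variables (c : nat -> nat) (K W p : nat).
Hypothesis c_le : forall j, c j <= p.
Hypothesis c_periodic : forall j, c (j + K.+1) = c j.

Definition mult v : nat := \sum_(j < K.+1) (c j == v).

(** A counter switch of rank [c j] reserves [W] ranks for its window and [mult (c j)] for the drift.
    The companion [clear_left] is the same condition for reversed ranks. *)
Definition clear_right y : Prop := forall j, ~~ (c j <= y < c j + W + mult (c j)).
Definition clear_left y : Prop := forall j, ~~ (y <= c j < y + W + mult (c j)).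

Lemma sum_shift (f : nat -> nat) s : (forall j, f (j + K.+1) = f j) ->
  \sum_(j < K.+1) f (s + j) = \sum_(j < K.+1) f j.
Proof.
move=> f_per; elim: s => // s <-.
rewrite big_ord_recr [RHS]big_ord_recl /= addnC addn0 addSnnS f_per; congr (_ + _).
by apply: eq_bigr => j _; rewrite /bump /= add1n addSnnS.
Qed.

Lemma mult_shift s v : \sum_(j < K.+1) (c (s + j) == v) = mult v.
Proof. by rewrite (sum_shift (f := fun j => c j == v :> nat)) // => j; rewrite c_periodic. Qed.

Lemma mult_gt0 j : 0 < mult (c j).
Proof. by rewrite -(mult_shift j) big_ord_recl addn0 eqxx. Qed.

Lemma sum_interval N v L : \sum_(y < N) (v <= y < v + L) <= L.
Proof.
suff : \sum_(y < N) (v <= y < v + L) <= minn L (N - v) by move/leq_trans; apply; exact: geq_minl.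
elim: N => [|N IH]; first by rewrite big_ord0.
rewrite big_ord_recr /=; set S := \sum_(_ < _) _ in IH *.
by case: (leqP v N) => h1; case: (ltnP N (v + L)) => h2 /=; lia.
Qed.

Lemma sum_mult : \sum_(v < p.+1) mult v = K.+1.
Proof.
rewrite exchange_big /= (eq_bigr (fun=> 1)) => [|j _]; first by rewrite sum_nat_const card_ord muln1.
pose v : 'I_p.+1 := Ordinal (c_le j : c j < p.+1).
by rewrite (bigD1 v) //= eqxx big1 // => w; rewrite -val_eqE /= eq_sym => /negbTE ->.
Qed.

(* Every value [v] excludes at most [2 * (W + mult v) <= 2 * (W + 1) * mult v] points. *)
Lemma clear_point a b : K.+1 * (W.+1 * 2) < b - a ->
  exists y, [/\ a <= y, y < b, clear_right y & clear_left y].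
Proof.
move=> big_ab.
pose bad y := [exists v : 'I_p.+1, (0 < mult v) &&
  ((v <= y < v + (W + mult v)) || (y <= v < y + (W + mult v)))].
have [/existsP[y /andP[ay /existsPn nb]]|none] :=
    boolP [exists y : 'I_b, (a <= y) && ~~ bad y].
  exists y; split=> // j; have := nb (Ordinal (c_le j : c j < p.+1)).
    by rewrite mult_gt0 /= negb_or !addnA => /andP[].
  by rewrite mult_gt0 /= negb_or !addnA => /andP[].
suff : b - a <= K.+1 * (W.+1 * 2) by rewrite leqNgt big_ab.
have -> : b - a = \sum_(y < b) (a <= y).
  rewrite {big_ab none}; elim: b => [|b IH]; first by rewrite big_ord0.
  by rewrite big_ord_recr /= -IH; case: leqP; lia.
(* The points excluded by [clear_left] end at [v]; they are enclosed in an interval starting at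
   [v.+1 - (W + mult v)]. Truncation at 0 only enlarges it. *)
apply: (@leq_trans (\sum_(y < b) \sum_(v < p.+1) (0 < mult v) *
  ((v <= y < v + (W + mult v)) + (v.+1 - (W + mult v) <= y < v.+1 - (W + mult v) + (W + mult v))))).
  apply: leq_sum => y _; case ay: (a <= y) => //.
  have : bad y by move/existsPn/(_ y): none; rewrite ay /= negbK.
  case/existsP => v /andP[v0 vy]; rewrite (bigD1 v) //= v0 mul1n.
  apply: leq_trans (leq_addr _ _); case/orP: vy => h; first by rewrite h.
  suff -> : v.+1 - (W + mult v) <= y < v.+1 - (W + mult v) + (W + mult v).
    by rewrite addn1.
  by apply/andP; lia.
rewrite exchange_big /= -sum_mult big_distrl /=; apply: leq_sum => v _.
rewrite -big_distrr /= big_split /=.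
have [m0|m0] := posnP (mult v); first by rewrite m0.
rewrite mul1n; apply: (@leq_trans ((W + mult v) * 2)); last by nia.
by rewrite muln2 -addnn leq_add // sum_interval.
Qed.

(** The largest pick below [y] becomes the rank of the counter switch; since [y] is clear, its
    window and drift fit before [y], and no other pick falls in between. Periodicity reduces the
    search to one period. *)
Lemma pick_below y j0 : clear_right y -> c j0 < y ->
  exists j, [/\ j < K.+1, c j < y, c j + W + mult (c j) <= y &
    forall t, (c t <= c j) || (y < c t)].
Proof.
move=> clr lt0.
have cmod t : c (t %% K.+1) = c t.
  have h k : c (t %% K.+1 + k * K.+1) = c (t %% K.+1).
    by elim: k => [|k IH]; rewrite ?addn0 // mulSnr addnA c_periodic.
  by rewrite [in RHS](divn_eq t K.+1) addnC h.
have lt_mod t : t %% K.+1 < K.+1 by rewrite ltn_mod.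
case: (@arg_maxnP _ (Ordinal (lt_mod j0)) (fun j : 'I_K.+1 => c j < y) (fun j => c j)).
  by rewrite /= cmod.
move=> j cj maxj; exists j; split=> //.
  by have := clr j; rewrite (ltnW cj) /= -leqNgt.
move=> t; rewrite orbC; case: ltnP => //= le_ty.
have := maxj (Ordinal (lt_mod t)); rewrite /= cmod; apply.
rewrite ltn_neqAle le_ty andbT; apply/eqP => tE.
by have := clr t; have := mult_gt0 t; rewrite tE; lia.
Qed.
End Gap.

Lemma key_of_pick n K T C (c ys : nat -> nat) j y :
  (forall j, c (j + K.+1) = c j)%N ->
  (forall j, 0 < c j <= n * 4 + n.+1 * K * 2 + T * 2 + C)%N ->
  (forall s, 0 < ys s <= n * 4 + n.+1 * K * 2 + T * 2 + C)%N ->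
  (c j < y)%N -> (c j + n * 4 + mult c K (c j) <= y)%N ->
  (forall t, (c t <= c j) || (y < c t))%N ->
  (n.+1 * K * 2 + n * 4 + K <= y)%N -> (y <= C.+1)%N ->
  exists key : item n K T C -> rat,
  [/\ forall i (t : 'I_K) b, phase i t T b ->
        rank_ok key b (Mov (Filler i t) (better b i)) (c (j.+1 + t)%N),
      forall i b j' d, phase i K T b -> next_real b j' d ->
        rank_ok key b (Mov (Real j' d) (better b j')) (c j) &
      forall (s : 'I_T) b, phase ord0 0 s b ->
        rank_ok key b (Mov (Tran s) false) (ys s)].
Proof.
move=> c_per c_b ys_b cjy gapy far loy yC.
pose x t := c (j.+1 + t)%N; pose Z := (n.+1 * K * 2)%N.
(* If more than [Z] ranks are available, the [Chk] items of fillers picked below [c j] are put on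
   the left too, which removes their drift. Otherwise [c j <= Z], and even a drift of [K] fits below
   [y]. *)
pose lc t := (x t < c j)%N && (Z < c j)%N.
pose lam := (\sum_(t < K) lc t)%N.
have lamK : (lam <= K)%N.
  by rewrite -[X in (_ <= X)%N]card_ord -sum1_card leq_sum // => t _; case: (lc t).
have lamZ : (n.+1 * lam * 2 <= (c j).-1)%N.
  have [ltZ|leZ] := ltnP Z (c j).
    suff : (n.+1 * lam * 2 <= Z)%N by lia.
    by rewrite leq_mul2r leq_mul2l lamK orbT.
  by rewrite /lam big1 ?muln0 // => t _; rewrite /lc [(Z < _)%N]ltnNge leZ andbF.
pose CL := ((c j).-1 - n.+1 * lam * 2)%N.
have cj0 : (0 < c j)%N by case/andP: (c_b j).
apply: (@arrangement n K T C x (c j) lc CL) => //.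
- by rewrite /CL; lia.
- by move=> t /andP[].
- by rewrite /nleft -/lam /CL subnK // prednK.
- move=> t _; have /orP[->//|yx] := far (j.+1 + t)%N.
  apply/orP; right; apply: leq_trans (ltnW yx).
  have [ltZ|leZ] := ltnP Z (c j); last first.
    have : (drift K x (c j) lc 0 <= K)%N.
      rewrite -[X in (_ <= X)%N]card_ord -sum1_card leq_sum // => k _.
      by case: [&& _, _ & _].
    by move: leZ loy; rewrite /Z; lia.
  (* Only fillers picked at rank [c j] itself drift; together with the counter switch there are
     [mult (c j)] such picks per period. *)
  apply: leq_trans gapy; rewrite leq_add2l -(mult_shift c_per j.+1) big_ord_recr /=.
  apply: leq_trans (leq_addr _ _); apply: leq_sum => k _.
  by rewrite /left /lc ltZ andbT -/(x k); case: ltngtP.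
- by move=> t; case/andP: (c_b (j.+1 + t)%N).
- by move=> t; case/andP: (c_b (j.+1 + t)%N).
Qed.

Lemma iter_collision (g : nat -> nat) l : (0 < l)%N -> (forall h, 0 < g h <= l)%N ->
  exists a b, [/\ (a < b)%N, (b <= l)%N & iter a g 1%N = iter b g 1%N].
Proof.
case: l => // l _ gb.
have iter_b k : (0 < iter k g 1 <= l.+1)%N by case: k => // k; rewrite iterS gb.
pose f (i : 'I_l.+2) : 'I_l.+1 := inord (iter i g 1%N).-1.
have /injectivePn[i [j ne eq_f]] : ~~ injectiveb f.
  by apply/injectiveP => /leq_card; rewrite !card_ord ltnn.
have eq_it : iter i g 1%N = iter j g 1%N.
  move/(congr1 (@nat_of_ord _)): eq_f; rewrite /f !inordK; first by have := iter_b i; have := iter_b j; lia.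
    by have := iter_b j; lia.
  by have := iter_b i; lia.
have [lt|lt|/val_inj eq] := ltngtP i j.
- by exists i, j; split=> //; rewrite -ltnS.
- by exists j, i; split=> //; rewrite -ltnS.
- by rewrite eq eqxx in ne.
Qed.

Definition mirror (m : bool) (p v : nat) : nat := if m then (p.+1 - v)%N else v.

Lemma rank_ok_mirror m n K T C (key : item n K T C -> rat) :
  let p := (#|{: follower n K T}| * 2 + C)%N in
  exists key' : item n K T C -> rat, forall b a q, (q <= p)%N ->
    rank_ok key b a (mirror m p q) -> rank_ok key' b a q.
Proof.
case: m => /=; last by exists key.
exists (fun a => - key a) => b a q le_q /rank_ok_opp.
by rewrite subKn // leqW.
Qed.

Lemma schedule n l p (idx g : nat -> nat) : (0 < l)%N ->
  (forall h, 0 < idx h <= p)%N -> (forall h, 0 < g h <= l)%N ->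
  p = (40 * (n.+1 * l.+1))%N ->
  exists K T C hs,
  [/\ [/\ (K < l)%N, (T <= l * 2)%N & (#|{: follower n K T}| * 2 + C)%N = p],
      iter K.+1 g hs = hs, iter T g 1%N = hs &
  exists key : item n K T C -> rat,
  [/\ forall i (t : 'I_K) b, phase i t T b ->
        rank_ok key b (Mov (Filler i t) (better b i)) (idx (iter t g hs)),
      forall i b j d, phase i K T b -> next_real b j d ->
        rank_ok key b (Mov (Real j d) (better b j)) (idx (iter K g hs)) &
      forall (s : 'I_T) b, phase ord0 0 s b ->
        rank_ok key b (Mov (Tran s) false) (idx (iter s g 1%N))]].
Proof.
move=> l0 idx_b g_b pE.
have [a [b [lt_ab le_bl eq_ab]]] := iter_collision l0 g_b.
pose K := (b - a).-1; have KE : K.+1 = (b - a)%N by rewrite /K; lia.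
pose h0 := iter a g 1%N; pose c j := idx (iter j g h0).
have h0_per : iter K.+1 g h0 = h0 by rewrite KE /h0 -iterD subnK ?eq_ab // ltnW.
have c_per j : c (j + K.+1)%N = c j by rewrite /c iterD h0_per.
have c_b j : (0 < c j <= p)%N by exact: idx_b.
have c_le j : (c j <= p)%N by case/andP: (c_b j).
set A := (n.+1 * l.+1)%N in pE.
have KA : (n.+1 * K <= A)%N by rewrite leq_mul2l; lia.
have nA : (n.+1 <= A)%N by rewrite leq_pmulr.
have lA : (l.+1 <= A)%N by rewrite leq_pmull.
(* The interval has length [14 * A], while at most [8 * A] points are excluded. The margins [13 * A]
   leave room for [Z], window and drift below, and above for [C >= p - 10 * A]. *)
have [|y [loy yhi clr cll]] := @clear_point c K (n * 4) p c_le c_per (13 * A)%N (p - 13 * A)%N.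
  have : (K.+1 * ((n * 4).+1 * 2) <= 8 * A)%N.
    apply: (@leq_trans (l.+1 * (n.+1 * 8))); last by rewrite /A; lia.
    by apply: leq_mul; lia.
  by lia.
have [m [y' [j0 [loy' yhi' clr' ltj0]]]] : exists m y' j0,
    [/\ (13 * A <= y')%N, (y' <= p.+1 - 13 * A)%N,
        clear_right (fun j => mirror m p (c j)) K (n * 4) y' &
        (mirror m p (c j0) < y')%N].
  have [/existsP[j0 lt0]|none] := boolP [exists j : 'I_K.+1, (c j < y)%N].
    by exists false, y, j0; split=> //; lia.
  (* All picks exceed [y]; reversing the order of the keys puts them below [p + 1 - y] and turns
     [clear_left] into [clear_right]. *)
  exists true, (p.+1 - y)%N, 0%N; rewrite /mirror; split; try lia.
    move=> j; have := cll j; have -> : mult (fun j => p.+1 - c j)%N K (p.+1 - c j)%N = mult c K (c j).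
      apply: eq_bigr => k _; have := c_le k; have := c_le j => h1 h2.
      by congr nat_of_bool; apply/eqP/eqP; lia.
    by have := c_le j; lia.
  move/existsPn/(_ ord0): none; have := clr 0%N.
  have := mult_gt0 c_per 0; have := c_le 0%N => /=; lia.
pose cc j := mirror m p (c j).
have mir_b v : (0 < v <= p)%N -> (0 < mirror m p v <= p)%N.
  by rewrite /mirror; case: (m) => //; lia.
have cc_per j : cc (j + K.+1)%N = cc j by rewrite /cc c_per.
have [j [lt_j ccj gapj far]] := pick_below cc_per clr' ltj0.
(* Transient followers absorb the preperiod of length [a] and [j + 1] further picks, so that every
   round ends with pick [j]. *)
pose T := (a + j.+1)%N; pose F := (n * 2 + n.+1 * K + T)%N.
have TE : (T <= l * 2)%N by rewrite /T; lia.
pose C := (p - F * 2)%N.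
have F_le : (F * 2 <= 10 * A)%N by rewrite /F; lia.
have FE : (#|{: follower n K T}| * 2 + C)%N = p.
  by rewrite card_follower /C -/F subnKC //; lia.
have pE' : (n * 4 + n.+1 * K * 2 + T * 2 + C)%N = p.
  by rewrite -[RHS]FE card_follower; lia.
exists K, T, C, (iter j.+1 g h0); split.
- by split=> //; lia.
- by rewrite -iterD addnC iterD h0_per.
- by rewrite /T addnC iterD.
have [key [key1 key2 key3]] := @key_of_pick n K T C cc
  (fun s => mirror m p (idx (iter s g 1%N))) j y' cc_per
  ltac:(by move=> k; rewrite pE'; apply/mir_b/c_b)
  ltac:(by move=> k; rewrite pE'; apply/mir_b/idx_b)
  ccj gapj far ltac:(by lia) ltac:(by rewrite /C; lia).
have [key' key'P] := rank_ok_mirror m key; rewrite FE in key'P.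
exists key'; split.
- move=> i t d ph; apply: key'P; first by case/andP: (idx_b (iter t g (iter j.+1 g h0))).
  by have := key1 i t d ph; rewrite /cc /c -iterD addnC.
- move=> i d j' e ph nr; apply: key'P.
    by case/andP: (idx_b (iter K g (iter j.+1 g h0))).
  have -> : idx (iter K g (iter j.+1 g h0)) = c j.
    by rewrite -(c_per j) /c -iterD; congr (idx (iter _ _ _)); lia.
  exact: key2 ph nr.
- move=> s d ph; apply: key'P; first by case/andP: (idx_b (iter s g 1%N)).
  exact: key3.
Qed.

(** For [n > 0] levels this makes [3 * p = 120 * (n + 1) * (l m + 1)] at most [m], and [3 * p]
    bounds the number of player 0 edges before [Pad] edges fill it up to [m]. *)
Definition levels (l : nat -> nat) m : nat := (m %/ (120 * (l m).+1)).-1.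

Lemma game_of_size l P m : index_selector l P ->
  exists X : {G : spg & {ffun V G -> V G}},
  [/\ is_spg (projT1 X), num_edges0 (projT1 X) = m, admissible (projT2 X) &
      (0 < levels l m)%N -> forall k, (k <= 2 * (2 ^ levels l m).-1)%N ->
        sorted_switches (si_run P (projT2 X) k).1 != [::]].
Proof.
move=> selP; set n := levels l m.
have [n0|n_gt0] := posnP n.
  (* Without levels, [m] pads with one edge each form the game. *)
  exists (existT _ (game m (fun=> 0)) (strat 0 m (@start 0 0 0))); split=> //=.
  - exact: game_is_spg.
  - by rewrite card_edges card_follower.
  - exact: strat_admissible.
have lm0 : (0 < l m)%N by have [_ /andP[h1 /(leq_trans h1)]] := selP 1%N m 0%N isT.
pose p := (40 * (n.+1 * (l m).+1))%N.
have p_gt0 : (0 < p)%N by [].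
have [K [T [C [hs [[_ _ FE] cyc reach [key [key1 key2 key3]]]]]]] :=
  @schedule n (l m) p (fun h => (P p m h).1) (fun h => (P p m h).2) lm0
    (fun h => (selP p m h p_gt0).1) (fun h => (selP p m h p_gt0).2) erefl.
have le_m : (#|{: follower n K T}| * 6 + C * 2 <= m)%N.
  apply: (@leq_trans (3 * p)); first by rewrite -FE; lia.
  have : (m %/ (120 * (l m).+1) * (120 * (l m).+1) <= m)%N by exact: leq_trunc_div.
  have : n.+1 = (m %/ (120 * (l m).+1))%N by rewrite /n /levels prednK //; move: n_gt0; rewrite /n /levels; lia.
  by move=> <-; rewrite /p; lia.
pose Q := (m - (#|{: follower n K T}| * 6 + C * 2))%N.
have mE : num_edges0 (game Q key) = m by rewrite card_edges /Q subnKC.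
exists (existT _ (game Q key) (strat C Q (@start n K T))); split=> //=.
- exact: game_is_spg.
- exact: strat_admissible.
move=> _ k; apply: (run_unfinished (idx := fun h => (P p m h).1)
  (g := fun h => (P p m h).2) (hs := hs)) => //.
by move=> h; rewrite FE mE; case: (P p m h).
Qed.

Lemma INR_expn a k : Raxioms.INR (a ^ k)%N = Rpow_def.pow (Raxioms.INR a) k.
Proof. by elim: k => // k IH; rewrite expnS -multE RIneq.mult_INR IH. Qed.

Lemma levels_growth l c : little_o_m_over_log l -> (forall m, 0 < l m)%N ->
  exists M, forall m, (M <= m)%N -> (0 < levels l m)%N && (m ^ c <= 2 ^ levels l m)%N.
Proof.
move=> lo l_gt0; have [M loM] := lo _ (threshold_pos c).
have [i3 i240] := INR_3_240.
exists (maxn M 3) => m; rewrite geq_max => /andP[Mm m3].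
have m3r := RIneq.le_INR 3 m (ssrnat.leP m3); rewrite i3 in m3r.
(* Here [l m + 1 <= 2 * l m] doubles 120, and [+ 2] makes up for the rounded quotient and the
   predecessor in [levels]. *)
have dm : (m <= (levels l m + 2) * (240 * l m))%N.
  have D0 : (0 < 120 * (l m).+1)%N by [].
  have := ltn_ceil m D0; have := l_gt0 m; rewrite /levels.
  set q := (m %/ _)%N => l0 lt; apply: leq_trans (ltnW lt) _.
  by apply: leq_mul; lia.
move/ssrnat.leP/RIneq.le_INR: dm.
rewrite -!multE -plusE !RIneq.mult_INR RIneq.plus_INR i240.
case/(pow_le_of_log erefl m3r (loM m Mm)) => n0 le_pow.
apply/andP; split; first exact/ssrnat.ltP/RIneq.INR_lt.
by apply/ssrnat.leP/RIneq.INR_le; rewrite !INR_expn.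
Qed.

Theorem theorem14 (l : nat -> nat) (P : nat -> nat -> nat -> nat * nat) :
  little_o_m_over_log l ->
  index_selector l P ->
  exists (G : nat -> spg) (s0 : forall m : nat, {ffun V (G m) -> V (G m)}),
    (forall m : nat,
        [/\ is_spg (G m), num_edges0 (G m) = m & admissible (s0 m)]) /\
    (forall c : nat, exists M : nat, forall m : nat, (M <= m)%N ->
        forall k : nat, (k < m ^ c)%N ->
          sorted_switches (si_run P (s0 m) k).1 != [::]).
Proof.
move=> lo selP.
pose X m := ClassicalEpsilon.constructive_indefinite_description _ (game_of_size m selP).
exists (fun m => projT1 (sval (X m))), (fun m => projT2 (sval (X m))).
split=> [m|c]; first by case: (svalP (X m)).
have l_gt0 m : (0 < l m)%N by have [_ /andP[h1 /(leq_trans h1)]] := selP 1%N m 0%N isT.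
have [M growth] := levels_growth c lo l_gt0; exists M => m /growth /andP[n_gt0 le_m] k lt_k.
case: (svalP (X m)) => _ _ _ run; apply: run => //.
apply: leq_trans (leq_trans (ltnW lt_k) le_m) _.
by have : (2 ^ 1 <= 2 ^ levels l m)%N by [rewrite leq_exp2l]; lia.
Qed.
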